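(* There exists an absolute constant $M>0$ such that for all integers $n\ge 2$, $q\ge 2$, every distribution $\mu$ on $[q]^n$, every robust universal coupler $\mathrm{UC}$ on $[q]$, and every integer $c\ge 1$, the parallel sampler run on $\mu$ with $\mathrm{UC}$ terminates within $cM\,(n\log n)^{2/3}\log q$ rounds with probability at least $1-2^{-c}$.
   Context: $\Delta_q$ is the probability simplex on $[q]$. Let $X=(X_1,\dots,X_n)\sim\mu$. For $S\subseteq[n]$, $\tau\in[q]^S$ and $i\in[n]$, $(X_i\mid X_S=\tau)\in\Delta_q$ denotes the conditional law of $X_i$ given $X_S=\tau$ (an arbitrary fixed element of $\Delta_q$ if the event has probability $0$). A universal coupler on $[q]$ is a deterministic map $f:\Delta_q\times\Omega\to[q]$, where $\Omega$ is a probability space of random seeds, such that for a random seed $r$, $\mathbb P[f(\nu,r)=x]=\nu(x)$ for all $\nu\in\Delta_q$, $x\in[q]$. It is robust if for every $m\ge1$ and $\nu_1,\dots,\nu_m\in\Delta_q$, $\mathbb P_r[\exists i,j\in[m]: f(\nu_i,r)\ne f(\nu_j,r)]\le \frac{\sum_{x\in[q]}(\max_i\nu_i(x)-\min_i\nu_i(x))}{\sum_{x\in[q]}\max_i\nu_i(x)}$. The parallel sampler: draw a uniformly random permutation $\sigma$ of $[n]$ and i.i.d. random seeds $u_1,\dots,u_n$; set $a\leftarrow0$, $t\leftarrow0$, $x^0$ arbitrary. Repeat (each repetition is one round): $t\leftarrow t+1$; for every $i\in[n]$ set $y^t_{\sigma(i)}=\mathrm{UC}\big((X_{\sigma(i)}\mid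 X_{\sigma(j)}=x^{t-1}_{\sigma(j)}\ \forall j\in[a]),u_i\big)$; then for every $i\in[n]$ set $x^t_{\sigma(i)}=\mathrm{UC}\big((X_{\sigma(i)}\mid X_{\sigma(j)}=y^t_{\sigma(j)}\ \forall j\in[i-1]),u_i\big)$. If $x^t=y^t$, output $x^t$ and stop. Otherwise set $a\leftarrow\min\{i\in[n]: y^t_{\sigma(i)}\ne x^t_{\sigma(i)}\}$; if $a=n$, output $x^t$ and stop. The number of rounds is the final value of $t$. *)

(* Defs.v *)
From HB Require Import structures.
From mathcomp Require Import all_boot all_order all_algebra all_fingroup.
From mathcomp Require Import all_classical all_reals all_analysis.
From mathcomp Require Export Rstruct.
Set Implicit Arguments. Unset Strict Implicit. Unset Printing Implicit Defensive.
Import Order.TTheory GRing.Theory Num.Theory.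
Local Open Scope classical_set_scope.
Local Open Scope ring_scope.

Section ParallelSampler.
Variable R : realType.

Definition is_dist (T : finType) (p : {ffun T -> R}) : bool :=
  [forall x, 0 <= p x] && (\sum_x p x == 1).

Definition simplex (q : nat) := {p : {ffun 'I_q -> R} | is_dist p}.

Definition cfg (n q : nat) := {ffun 'I_n -> 'I_q}.

Definition cond_mass n q (mu : {ffun cfg n q -> R}) (S : {set 'I_n})
  (tau : cfg n q) : R :=
  \sum_(z : cfg n q | [forall j in S, z j == tau j]) mu z.

Definition cond_law_raw n q (mu : {ffun cfg n q -> R}) (S : {set 'I_n})
  (tau : cfg n q) (i : 'I_n) : {ffun 'I_q -> R} :=
  [ffun x => (\sum_(z : cfg n q | [forall j in S, z j == tau j] && (z i == x)) mu z)
             / cond_mass mu S tau].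

(* (X_i | X_S = tau) in Delta_q; nu0 is the arbitrary fixed element used when
   mu(X_S = tau) = 0.  (When mu is a distribution and the event has positive
   probability, cond_law_raw is a distribution, see cond_law_raw_dist, so the
   insubd is then the identity.) *)
Definition cond_law n q (mu : {ffun cfg n q -> R}) (nu0 : simplex q)
  (S : {set 'I_n}) (tau : cfg n q) (i : 'I_n) : simplex q :=
  if 0 < cond_mass mu S tau then insubd nu0 (cond_law_raw mu S tau i) else nu0.

Definition universal_coupler d (Omega : measurableType d)
  (P : probability Omega R) q (f : simplex q -> Omega -> 'I_q) : Prop :=
  forall (nu : simplex q) (x : 'I_q),
    measurable [set r | f nu r = x] /\
    P [set r | f nu r = x] = (sval nu x)%:E.

Definition robust_coupler d (Omega : measurableType d)
  (P : probability Omega R) q (f : simplex q -> Omega -> 'I_q) : Prop :=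
  universal_coupler P f /\
  forall (m : nat) (nu : 'I_m -> simplex q), (1 <= m)%N ->
    (P [set r | exists i j, f (nu i) r <> f (nu j) r] <=
    ((\sum_(x : 'I_q) (\big[Order.max/0]_(i < m) sval (nu i) x
                        - \big[Order.min/1]_(i < m) sval (nu i) x))
      / (\sum_(x : 'I_q) \big[Order.max/0]_(i < m) sval (nu i) x))%:E)%E.

Definition prefix_set n (s : {perm 'I_n}) (k : nat) : {set 'I_n} :=
  [set s j | j : 'I_n & (j < k)%N].

Section Run.
Variables (n q : nat) (mu : {ffun cfg n q -> R}) (nu0 : simplex q).
Variables (d : measure_display) (Omega : measurableType d).
Variable (f : simplex q -> Omega -> 'I_q).
Variables (sigma : {perm 'I_n}) (u : 'I_n -> Omega).
(* u i is the seed u_{i+1} of the paper (0-indexed), used at vertex sigma i. *)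

Definition round_y (a : nat) (xprev : cfg n q) : cfg n q :=
  [ffun v => f (cond_law mu nu0 (prefix_set sigma a) xprev v) (u (sigma^-1 v)%g)].

Definition round_x (y : cfg n q) : cfg n q :=
  [ffun v => f (cond_law mu nu0 (prefix_set sigma (sigma^-1 v)%g) y v) (u (sigma^-1 v)%g)].

Fixpoint halts_within (T : nat) (a : nat) (xprev : cfg n q) : bool :=
  match T with
  | 0 => false
  | T'.+1 =>
      let y := round_y a xprev in
      let x := round_x y in
      (x == y) ||
      (let a' := (\big[minn/n]_(k : 'I_n | y (sigma k) != x (sigma k)) (k : nat)).+1 in
       (a' == n) || halts_within T' a' x)
  end.
End Run.

Definition sampler_randomness d (Omega : measurableType d) (P : probability Omega R)
  d' (Omega' : measurableType d') (P' : probability Omega' R) (n : nat)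
  (sigma : Omega' -> {perm 'I_n}) (U : 'I_n -> Omega' -> Omega) : Prop :=
  (forall s, measurable (sigma @^-1` [set s])) /\
  (forall i, measurable_fun setT (U i)) /\
  forall (s : {perm 'I_n}) (A : 'I_n -> set Omega), (forall i, measurable (A i)) ->
    P' [set w | sigma w = s /\ forall i, A i (U i w)] =
    (((n`!%:R)^-1)%:E * \prod_(i < n) P (A i))%E.

End ParallelSampler.

Lemma cond_law_raw_dist (R : realType) n q (mu : {ffun cfg n q -> R})
  (S : {set 'I_n}) (tau : cfg n q) (i : 'I_n) :
  is_dist mu -> 0 < cond_mass mu S tau -> is_dist (cond_law_raw mu S tau i).
Proof.
move=> /andP[/forallP mu0 _] D0; apply/andP; split.
  apply/forallP => x; rewrite ffunE.
  apply: divr_ge0; last exact: ltW.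
  by apply: sumr_ge0 => z _; exact: mu0.
under eq_bigr do rewrite ffunE.
rewrite -mulr_suml -(partition_big (fun z : cfg n q => z i) predT) //.
by rewrite divff // gt_eqF.
Qed.

(* Main.v *)
(* In a round anchored at [a], the first position [i > a] where [f(nu_a, u_i)]
   differs from [f(nu_(i-1), u_i)] becomes the next anchor, where [nu_k] is the law
   of the coordinate visited at step [i] given the first [k] revealed ones; so the
   number of rounds is the number of disagreements met while revealing the output
   one coordinate at a time. Robustness applied to the two laws bounds the
   probability of a disagreement by [|nu_(i-1) - nu_a|_1], hence by
   [1/l + l KL(nu_(i-1) || nu_a)] for every [l >= 1]. Averaging over the next
   coordinate, the KL terms of a round are paid by the decrease of the total
   entropy [H <= r ln q] of the [r] hidden coordinates, divided by [r], which
   accounts for a factor [ln n]. A round that reveals more than [l] coordinates is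
   paid by the decrease of [r / l]. This gives an explicit supermartingale bounding
   the expected number [B] of remaining rounds by
   [O(l^2 ln q ln n + n / l)] from every state, and therefore
   [E (1 + 1/(2B))^N <= 2] for the number [N] of rounds. The seeds matter only
   through their values at finitely many conditional laws, so everything reduces to
   a finite probability space. *)
Require Import Defs.
From HB Require Import structures.
From mathcomp Require Import all_boot all_order all_algebra all_fingroup.
From mathcomp Require Import all_classical all_reals all_analysis.
From mathcomp Require Import Rstruct.
From mathcomp Require Import ring lra zify.
Import Order.TTheory GRing.Theory Num.Theory.
Local Open Scope classical_set_scope.
Local Open Scope ring_scope.
Set Implicit Arguments.
Unset Strict Implicit.
Unset Printing Implicit Defensive.

(** * Conditional laws of one coordinate and their behaviour when another is revealed *)

Section ConditionalLaws.
Variables (R : realType) (n q : nat) (mu : {ffun cfg n q -> R}).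
Variable nu0 : simplex R q.
Hypothesis mu_dist : is_dist mu.
Implicit Types (S : {set 'I_n}) (t : cfg n q) (u v w : 'I_n) (x z : 'I_q).

Definition cl (S : {set 'I_n}) (t : cfg n q) (v : 'I_n) (x : 'I_q) : R :=
  sval (cond_law mu nu0 S t v) x.

Definition upd (t : cfg n q) (v : 'I_n) (z : 'I_q) : cfg n q :=
  [ffun w => if w == v then z else t w].

Lemma updE t v z : upd t v z v = z.
Proof. by rewrite ffunE eqxx. Qed.

Lemma upd_other t v z w : w != v -> upd t v z w = t w.
Proof. by rewrite ffunE => /negbTE->. Qed.

Lemma simplex_ge0 (nu : simplex R q) x : 0 <= sval nu x.
Proof. by case: nu => nu /= /andP[/forallP]. Qed.

Lemma simplex_sum (nu : simplex R q) : \sum_x sval nu x = 1.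
Proof. by case: nu => nu /= /andP[_ /eqP]. Qed.

Lemma cl_ge0 S t v x : 0 <= cl S t v x.
Proof. exact: simplex_ge0. Qed.

Lemma cl_sum S t v : \sum_x cl S t v x = 1.
Proof. exact: simplex_sum. Qed.

Lemma cl_le1 S t v x : cl S t v x <= 1.
Proof.
rewrite -(cl_sum S t v) (bigD1 x) //= lerDl.
by apply: sumr_ge0 => y _; exact: cl_ge0.
Qed.

Lemma mu_ge0 (y : cfg n q) : 0 <= mu y.
Proof. by case/andP: mu_dist => /forallP. Qed.

Lemma clE S t v x : 0 < cond_mass mu S t ->
  cl S t v x = (\sum_(z : cfg n q | [forall j in S, z j == t j] && (z v == x)) mu z)
               / cond_mass mu S t.
Proof.
move=> S0; rewrite /cl /cond_law S0 /insubd insubT /=.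
  exact: cond_law_raw_dist.
by move=> h; rewrite ffunE.
Qed.

Lemma eq_forall_in (S : {set 'I_n}) (t t' z : cfg n q) : {in S, t =1 t'} ->
  [forall j in S, z j == t j] = [forall j in S, z j == t' j].
Proof.
by move=> tt'; apply: eq_forallb => j; case: (boolP (j \in S)) => //= /tt' ->.
Qed.

Lemma cond_law_agree S t t' v : {in S, t =1 t'} ->
  cond_law mu nu0 S t v = cond_law mu nu0 S t' v.
Proof.
move=> tt'; have cmE : cond_mass mu S t = cond_mass mu S t'.
  by apply: eq_bigl => z; rewrite (eq_forall_in _ tt').
rewrite /cond_law cmE; case: ifP => // _; congr insubd.
apply/ffunP => x; rewrite !ffunE cmE; congr (_ / _).
by apply: eq_bigl => z; rewrite (eq_forall_in _ tt').
Qed.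

Lemma forall_in_setU1 (S : {set 'I_n}) t u z (y : cfg n q) : u \notin S ->
  [forall j in u |: S, y j == upd t u z j] =
  [forall j in S, y j == t j] && (y u == z).
Proof.
move=> uS; apply/forall_inP/andP => [h|[/forall_inP h /eqP yu] j].
  split; last by have := h u; rewrite setU11 updE; exact.
  apply/forall_inP => j jS; have := h j; rewrite setU1r // upd_other; first exact.
  by apply: contraNneq uS => <-.
rewrite in_setU1 => /predU1P[->|jS]; first by rewrite updE yu.
by rewrite upd_other ?h //; apply: contraNneq uS => <-.
Qed.

Lemma cond_mass_setU1 S t u z : u \notin S -> 0 < cond_mass mu S t ->
  cond_mass mu (u |: S) (upd t u z) = cl S t u z * cond_mass mu S t.
Proof.
move=> uS S0; rewrite clE // divfK ?gt_eqF //.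
by apply: eq_bigl => y; rewrite forall_in_setU1.
Qed.

Lemma cond_mass_setU1_gt0 S t u z : u \notin S -> 0 < cond_mass mu S t ->
  0 < cl S t u z -> 0 < cond_mass mu (u |: S) (upd t u z).
Proof. by move=> uS S0 z0; rewrite cond_mass_setU1 ?mulr_gt0. Qed.

Lemma cl_martingale S t u v x : u \notin S -> 0 < cond_mass mu S t ->
  \sum_z cl S t u z * cl (u |: S) (upd t u z) v x = cl S t v x.
Proof.
move=> uS S0; rewrite [RHS]clE //.
rewrite (partition_big (fun y : cfg n q => y u) predT) //= mulr_suml.
(* A value [z] of probability zero gives zero on both sides, so the default law used after revealing
   it never enters. *)
apply: eq_bigr => z _; have [z0|z0] := eqVneq (cl S t u z) 0.
  rewrite z0 mul0r big1 ?mul0r // => y /andP[/andP[yS _] yu].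
  apply/eqP; rewrite eq_le mu_ge0 andbT.
  have <- : cond_mass mu (u |: S) (upd t u z) = 0 by rewrite cond_mass_setU1 // z0 mul0r.
  rewrite /cond_mass (bigD1 y) /=; last by rewrite forall_in_setU1 // yS.
  by rewrite lerDl sumr_ge0 // => ? _; exact: mu_ge0.
have z_gt0 : 0 < cl S t u z by rewrite lt0r z0 cl_ge0.
rewrite [X in _ * X]clE; last exact: cond_mass_setU1_gt0.
rewrite cond_mass_setU1 // invfM mulrCA (mulrA (cl S t u z)) divff // mul1r.
by congr (_ / _); apply: eq_bigl => y; rewrite forall_in_setU1 // andbAC.
Qed.

Lemma cl_revealed S t v x : v \in S -> 0 < cond_mass mu S t ->
  cl S t v x = (x == t v)%:R.
Proof.
move=> vS S0; rewrite clE //; have [->|xt] := eqVneq x (t v).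
  rewrite -[RHS](divff (lt0r_neq0 S0)); congr (_ / _).
  apply: eq_bigl => y; apply: andb_idr => /forall_inP; exact.
rewrite big_pred0 ?mul0r // => y; apply/negbTE/negP => /andP[/forall_inP/(_ _ vS)/eqP->].
by rewrite eq_sym (negbTE xt).
Qed.

(** The numerator for [S] is a sub-sum of the nonnegative terms for [S0]. Hence divergences between
    such laws are finite and the convention [ln 0 = 0] does no harm. *)
Lemma cl_abs_cont S0 t0 S t v x : S0 \subset S -> {in S0, t0 =1 t} ->
  0 < cond_mass mu S t -> cl S0 t0 v x = 0 -> cl S t v x = 0.
Proof.
move=> SS tt Sp.
have sub (z : cfg n q) : [forall j in S, z j == t j] -> [forall j in S0, z j == t0 j].
  move=> /forall_inP h; apply/forall_inP => j jS.
  by rewrite tt // h // (fintype.subsetP SS).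
have Sp0 : 0 < cond_mass mu S0 t0.
  apply: lt_le_trans Sp _; 
  rewrite [leRHS](bigID (fun z : cfg n q => [forall j in S, z j == t j])) /=.
  rewrite [X in X + _ >= _](eq_bigl (fun z : cfg n q => [forall j in S, z j == t j])).
    by rewrite lerDl sumr_ge0 // => z _; exact: mu_ge0.
  by move=> z; apply: andb_idl; exact: sub.
rewrite !clE // => /eqP; rewrite mulf_eq0 invr_eq0 (gt_eqF Sp0) orbF.
rewrite psumr_eq0; last by move=> z _; exact: mu_ge0.
move=> /allP h; rewrite big1 ?mul0r // => z /andP[zS zx].
by have := h z (mem_index_enum _); rewrite sub // zx /= => /eqP.
Qed.

End ConditionalLaws.

(** * Scalar inequalities of Pinsker and Gibbs type *)

Section EntropyInequalities.
Variable R : realType.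
Implicit Types (a b x : R) (l : nat).

Lemma ln_le_subr1 x : 0 < x -> ln x <= x - 1.
Proof. by move=> x0; rewrite -{1}(subrKC 1 x) le_ln1Dx // ltrBrDl subrr. Qed.

(* From [ln (sqrt a / sqrt b) <= sqrt a / sqrt b - 1]. *)
Lemma sqr_sqrt_sub_le_kl a b : 0 <= a -> 0 <= b -> (a = 0 -> b = 0) ->
  (Num.sqrt b - Num.sqrt a) ^+ 2 <= b * (ln b - ln a) - b + a.
Proof.
move=> a0 b0 ab; have [->|bN0] := eqVneq b 0.
  by rewrite sqrtr0 mul0r sub0r sqrrN sqr_sqrtr // subr0 add0r.
have b_gt0 : 0 < b by rewrite lt0r bN0.
have a_gt0 : 0 < a by rewrite lt0r a0 andbT; apply: contraNneq bN0 => /ab ->.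
rewrite -{2 3 4}(sqr_sqrtr b0) -{2 3}(sqr_sqrtr a0).
have : 0 < Num.sqrt b by rewrite sqrtr_gt0.
have : 0 < Num.sqrt a by rewrite sqrtr_gt0.
move: (Num.sqrt a) (Num.sqrt b) => u v u0 v0.
rewrite !lnXn //.
have := @ln_le_subr1 (u / v) (divr_gt0 u0 v0).
rewrite ln_div // => h.
have {}h : v ^+ 2 * (ln u - ln v) <= v ^+ 2 * (u / v - 1).
  by rewrite ler_pM2l // exprn_gt0.
have E : v ^+ 2 * (u / v - 1) = u * v - v ^+ 2 by field; rewrite gt_eqF.
rewrite E in h; rewrite !mulr2n.
lra.
Qed.

Lemma kl_term_ge0 a b : 0 <= a -> 0 <= b -> (a = 0 -> b = 0) ->
  0 <= b * (ln b - ln a) - b + a.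
Proof.
by move=> a0 b0 /(sqr_sqrt_sub_le_kl a0 b0); apply: le_trans; exact: sqr_ge0.
Qed.

(* [|b - a| = |sqrt b - sqrt a| (sqrt b + sqrt a)] and AM-GM. *)
Lemma dist_le_kl_term l a b : (0 < l)%N ->
  0 <= a -> 0 <= b -> (a = 0 -> b = 0) ->
  `|b - a| <= (a + b) / (2 * l%:R) + l%:R * (b * (ln b - ln a) - b + a).
Proof.
move=> l0 a0 b0 ab.
have L0 : (0 : R) < l%:R by rewrite ltr0n.
apply: le_trans (_ : (a + b) / (2 * l%:R) + l%:R * (Num.sqrt b - Num.sqrt a) ^+ 2 <= _);
  last by rewrite lerD2l ler_pM2l // sqr_sqrt_sub_le_kl.
rewrite -{1 2}(sqr_sqrtr b0) -{1 2}(sqr_sqrtr a0).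
move: (Num.sqrt a) (Num.sqrt b) (sqrtr_ge0 a) (sqrtr_ge0 b) => u v u0 v0.
rewrite subr_sqr normrM (ger0_norm (addr_ge0 v0 u0)).
have := sqr_ge0 (2 * l%:R * `|v - u| - (v + u)).
rewrite -[X in l%:R * X]real_normK ?num_real //.
have := sqr_ge0 (v - u); move: `|v - u| => w h1 h2.
rewrite -(ler_pM2l (_ : 0 < 4 * l%:R)); last by rewrite mulr_gt0.
have -> : 4 * l%:R * ((u ^+ 2 + v ^+ 2) / (2 * l%:R) + l%:R * w ^+ 2) =
  2 * (u ^+ 2 + v ^+ 2) + 4 * (l%:R * l%:R) * w ^+ 2 by field; rewrite gt_eqF.
nra.
Qed.

(** This is [kl_term_ge0] against the mass [c^-1]; with [c = q], summing over [q] values bounds an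
    entropy by [ln q]. *)
Lemma entropy_term_le b c : 0 <= b -> 0 < c ->
  - (b * ln b) <= b * ln c + c^-1 - b.
Proof.
move=> b0 c0; have := @kl_term_ge0 c^-1 b.
rewrite invr_ge0 (ltW c0) b0 => /(_ isT isT).
have cN : c^-1 <> 0 by apply/eqP; rewrite invr_neq0 // gt_eqF.
move=> /(_ (fun h => False_ind _ (cN h))); rewrite lnV //; lra.
Qed.

End EntropyInequalities.

(** * Coordinatewise entropy, cross entropy and divergence *)

Section Entropy.
Variables (R : realType) (n q : nat) (mu : {ffun cfg n q -> R}).
Variable nu0 : simplex R q.
Hypothesis mu_dist : is_dist mu.
Implicit Types (A B : {set 'I_n} * cfg n q) (u v : 'I_n).
Let p B v x : R := cl mu nu0 B.1 B.2 v x.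

Definition positive B := 0 < cond_mass mu B.1 B.2.

Definition extends A B :=
  [/\ A.1 \subset B.1, {in A.1, A.2 =1 B.2} & positive B].

Definition reveal B u z : {set 'I_n} * cfg n q := (u |: B.1, upd B.2 u z).

(** One-coordinate cross entropies are added up over all coordinates; this is not a joint entropy.
    It is linear in the laws at [B], and at [A = B] it is the total entropy. *)
Definition cross_entropy A B : R := \sum_v \sum_x - (p B v x * ln (p A v x)).

Definition kl A B v : R := \sum_x p B v x * (ln (p B v x) - ln (p A v x)).

Lemma extends_refl B : positive B -> extends B B. Proof. by split. Qed.

Lemma extends_reveal A B u z : u \notin B.1 -> extends A B -> 0 < p B u z ->
  extends A (reveal B u z).
Proof.
move=> uB [AB tAB Bp] z0; split => /=.
- by apply: (fintype.subset_trans AB); apply/fintype.subsetP => w wB; rewrite setU1r.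
- move=> w wA; rewrite upd_other ?tAB //; apply: contraNneq uB => <-.
  exact: (fintype.subsetP AB).
- exact: (cond_mass_setU1_gt0 mu_dist uB Bp z0).
Qed.

Lemma extends_abs_cont A B v x : extends A B -> p A v x = 0 -> p B v x = 0.
Proof. by case=> ? ? ?; exact: cl_abs_cont. Qed.

Lemma cross_entropy_ge0 A B : 0 <= cross_entropy A B.
Proof.
apply: sumr_ge0 => v _; apply: sumr_ge0 => x _.
by rewrite -mulrN mulr_ge0 ?cl_ge0 // oppr_ge0 ln_le0 // cl_le1.
Qed.

Lemma kl_sumE A B : \sum_v kl A B v = cross_entropy A B - cross_entropy B B.
Proof.
rewrite -sumrB; apply: eq_bigr => v _; rewrite -sumrB; apply: eq_bigr => x _.
by rewrite mulrBr opprK addrC.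
Qed.

(** Both laws have mass one, so the shifts cancel; each shifted summand is nonnegative, which the
    summands of [kl] need not be. *)
Lemma kl_shiftE A B v :
  kl A B v = \sum_x (p B v x * (ln (p B v x) - ln (p A v x)) - p B v x + p A v x).
Proof. by rewrite big_split /= sumrB !cl_sum addrNK. Qed.

Lemma kl_ge0 A B v : extends A B -> 0 <= kl A B v.
Proof.
move=> AB; rewrite kl_shiftE; apply: sumr_ge0 => x _.
by apply: kl_term_ge0; rewrite ?cl_ge0 //; exact: extends_abs_cont.
Qed.

Lemma entropy_le_cross_entropy A B : extends A B ->
  cross_entropy B B <= cross_entropy A B.
Proof.
by move=> AB; rewrite -subr_ge0 -kl_sumE sumr_ge0 // => v _; exact: kl_ge0.
Qed.

(** A Pinsker bound made linear in the divergence by the free parameter [l], so that it can be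
    summed over coordinates. *)
Lemma dist_le_kl (l : nat) A B v : (0 < l)%N -> extends A B ->
  \sum_x `|p B v x - p A v x| <= l%:R^-1 + l%:R * kl A B v.
Proof.
move=> l0 AB.
have -> : l%:R^-1 + l%:R * kl A B v =
  \sum_x ((p A v x + p B v x) / (2 * l%:R) + l%:R *
    (p B v x * (ln (p B v x) - ln (p A v x)) - p B v x + p A v x)).
  rewrite big_split /= -mulr_suml big_split /= !cl_sum -mulr_sumr -kl_shiftE.
  by congr (_ + _); field; rewrite pnatr_eq0 -lt0n.
apply: ler_sum => x _.
by apply: dist_le_kl_term; rewrite ?cl_ge0 //; exact: extends_abs_cont.
Qed.

(** Only the weights [p B v x] change under a reveal, and they are martingales; the logarithms stay
    those of [A]. *)
Lemma cross_entropy_martingale A B u : u \notin B.1 -> positive B ->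
  \sum_z p B u z * cross_entropy A (reveal B u z) = cross_entropy A B.
Proof.
move=> uB Bp.
under eq_bigr do rewrite mulr_sumr.
rewrite exchange_big; apply: eq_bigr => v _ /=.
under eq_bigr do rewrite mulr_sumr.
rewrite exchange_big; apply: eq_bigr => x _ /=.
rewrite -[in RHS](cl_martingale nu0 mu_dist v x uB Bp : _ = p B v x) mulr_suml -sumrN.
by apply: eq_bigr => z _; rewrite mulrN mulrA.
Qed.

(** Gibbs' inequality replaces the logarithms after the reveal by those before it, and the resulting
    cross entropy is a martingale. *)
Lemma entropy_supermartingale B u : u \notin B.1 -> positive B ->
  \sum_z p B u z * cross_entropy (reveal B u z) (reveal B u z) <= cross_entropy B B.
Proof.
move=> uB Bp; rewrite -[leRHS](cross_entropy_martingale B uB Bp).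
apply: ler_sum => z _; have := cl_ge0 mu nu0 B.1 B.2 u z.
rewrite -/(p B u z) le0r => /predU1P[->|z0]; first by rewrite !mul0r.
rewrite ler_pM2l // entropy_le_cross_entropy //.
by apply: extends_reveal => //; exact: extends_refl.
Qed.

(** Revealed coordinates have point masses and contribute nothing; each hidden one is compared with
    the uniform law. *)
Lemma entropy_le_card B : (0 < q)%N -> positive B ->
  cross_entropy B B <= (#|~: B.1|)%:R * ln q%:R.
Proof.
move=> q0 Bp; rewrite /cross_entropy (bigID (mem B.1)) /= big1 => [|v vB].
  rewrite add0r -sum1_card natr_sum mulr_suml.
  rewrite [leRHS](eq_bigl (fun v => v \notin B.1)); last by move=> v; rewrite inE.
  apply: ler_sum => v _; rewrite mul1r.
  apply: le_trans (ler_sum _ (fun x _ => entropy_term_le (cl_ge0 mu nu0 _ _ v x)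
    (_ : (0 : R) < q%:R))) _; first by rewrite ltr0n.
  rewrite sumrB big_split /= -mulr_suml !cl_sum mul1r sumr_const card_ord.
  by rewrite -[X in _ + X - _]mulr_natr mulVf ?pnatr_eq0 -?lt0n // addrK.
apply: big1 => x _; rewrite /p cl_revealed //.
by case: (x == _); rewrite ?ln1 ?mulr0 ?mul0r oppr0.
Qed.

End Entropy.

(** * Averaging over a uniform order and independent finite seeds *)

Section RandomOrder.
Variables (R : realType) (n : nat).

Definition trace (G : Type) (s : 'I_n -> 'I_n) (gs : 'I_n -> G) : seq ('I_n * G) :=
  [seq (s i, gs i) | i <- enum 'I_n].

Lemma size_trace G s (gs : 'I_n -> G) : size (trace s gs) = n.
Proof. by rewrite size_map -cardE card_ord. Qed.

Lemma take_traceS G s (gs : 'I_n -> G) (i : 'I_n) :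
  take i.+1 (trace s gs) = rcons (take i (trace s gs)) (s i, gs i).
Proof.
rewrite (take_nth (s i, gs i)) ?size_trace //; congr rcons.
by rewrite (nth_map i) -?cardE ?card_ord // nth_ord_enum.
Qed.

Lemma trace_inj (G : eqType) (s s' : {perm 'I_n}) (gs gs' : {ffun 'I_n -> G}) :
  trace s gs = trace s' gs' -> (s, gs) = (s', gs').
Proof.
move=> /eq_in_map h; congr pair.
  by apply/permP => i; have := h i; rewrite mem_enum => /(_ isT) [].
by apply/ffunP => i; have := h i; rewrite mem_enum => /(_ isT) [].
Qed.

Lemma uniq_trace (G : Type) (s : {perm 'I_n}) (gs : 'I_n -> G) i :
  uniq (map fst (take i (trace s gs))).
Proof.
rewrite map_take take_uniq // -map_comp map_inj_uniq ?enum_uniq //.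
exact: perm_inj.
Qed.

Variables (G : finType) (wt : G -> R) (val : seq ('I_n * G) -> R).
Hypothesis wt_ge0 : forall g, 0 <= wt g.
Hypothesis val_ge0 : forall h, 0 <= val h.
Hypothesis val_step : forall h, uniq (map fst h) -> all (fun x => 0 < wt x.2) h ->
  (size h < n)%N ->
  \sum_(u | u \notin map fst h) \sum_g wt g * val (rcons h (u, g)) <=
  (n - size h)%:R * val h.

Implicit Types (w : {perm 'I_n} * {ffun 'I_n -> G}) (h : seq ('I_n * G)).

Let weight w := \prod_i wt (w.2 i).

Let weightE w : weight w = \prod_(x <- trace w.1 w.2) wt x.2.
Proof. by rewrite big_map big_enum. Qed.

(** Induction on the number of steps after [h]: completions of [h] are grouped by their next entry.
    With [k.+1] coordinates left, [val_step] contributes a factor [k.+1], which builds up the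
    factorial. *)
Lemma sum_val_prefix k h : (size h + k)%N = n ->
  \sum_(w : {perm 'I_n} * {ffun 'I_n -> G} | take (size h) (trace w.1 w.2) == h)
    weight w * val (trace w.1 w.2) <=
  k`!%:R * (\prod_(x <- h) wt x.2) * val h.
Proof.
elim: k h => [|k IH] h szh.
  have rhs0 : 0 <= 0`!%:R * (\prod_(x <- h) wt x.2) * val h.
    by rewrite !mulr_ge0 ?prodr_ge0.
  have full w : take (size h) (trace w.1 w.2) = trace w.1 w.2 :> seq ('I_n * G).
    by rewrite take_oversize // size_trace -[leqLHS]szh addn0.
  case: (pickP (fun w : {perm 'I_n} * {ffun 'I_n -> G} =>
    take (size h) (trace w.1 w.2) == h)) => [w0 /eqP w0h|none]; last first.
    by rewrite (eq_bigl _ _ none) big_pred0_eq.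
  rewrite full in w0h; rewrite (big_pred1 w0) => [|w].
    by rewrite fact0 mul1r w0h weightE w0h.
  rewrite /= full -w0h; apply/eqP/eqP => [/trace_inj|->//].
  by case: w w0 {w0h} => [? ?] [? ?].
have rhs0 : 0 <= (k.+1)`!%:R * (\prod_(x <- h) wt x.2) * val h.
  by rewrite !mulr_ge0 ?prodr_ge0.
have hn : (size h < n)%N by lia.
(* A history with a repeated vertex is no prefix of a trace, so the sum is empty. *)
have [uh|nuh] := boolP (uniq (map fst h)); last first.
  rewrite [leLHS]big_pred0 => [//|w].
  by apply: contraNF nuh => /eqP <-; exact: uniq_trace.
(* A seed of weight zero in [h] makes every product vanish. *)
have [ph|/allPn[x xh x0]] := boolP (all (fun x => 0 < wt x.2) h); last first.
  rewrite [leLHS]big1 => [//|w /eqP wh].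
  have xw : x \in trace w.1 w.2 by apply: (@mem_take (size h)); rewrite wh.
  rewrite weightE (perm_big _ (perm_to_rem xw)) big_cons /=.
  suff -> : wt x.2 = 0 by rewrite !mul0r.
  by apply/eqP; rewrite eq_le wt_ge0 leNgt x0.
pose i0 := Ordinal hn.
rewrite (partition_big (fun w : {perm 'I_n} * {ffun 'I_n -> G} => (w.1 i0, w.2 i0)) predT) //=.
apply: (@le_trans _ _ (\sum_(ug : 'I_n * G | ug.1 \notin map fst h)
    k`!%:R * ((\prod_(x <- h) wt x.2) * wt ug.2) * val (rcons h ug))).
  rewrite [leRHS]big_mkcond; apply: ler_sum => -[u g] _ /=.
  have takeS w : (take (size h) (trace w.1 w.2) == h) && ((w.1 i0, w.2 i0) == (u, g)) =
    (take (size (rcons h (u, g))) (trace w.1 w.2) == rcons h (u, g)).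
    by rewrite size_rcons (take_traceS w.1 w.2 i0) eqseq_rcons.
  rewrite (eq_bigl _ _ takeS); case: ifPn => [_|].
    apply: le_trans (IH _ _) _; first by rewrite size_rcons addSn -addnS.
    by rewrite -cats1 big_cat big_seq1.
  rewrite negbK => uh'; rewrite big_pred0 // => w; apply/negbTE/eqP => wh.
  have := uniq_trace w.1 w.2 (size (rcons h (u, g))).
  by rewrite wh map_rcons rcons_uniq uh'.
have -> : \sum_(ug : 'I_n * G | ug.1 \notin map fst h)
    k`!%:R * ((\prod_(x <- h) wt x.2) * wt ug.2) * val (rcons h ug) =
  k`!%:R * ((\prod_(x <- h) wt x.2) *
    \sum_(u | u \notin map fst h) \sum_g wt g * val (rcons h (u, g))).
  rewrite pair_big_dep /= !mulr_sumr.
  by apply: eq_big => [ug|[u g] _] /=; rewrite ?andbT ?mulrA.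
rewrite factS natrM -!mulrA [leRHS]mulrCA ler_wpM2l //.
rewrite [leRHS]mulrCA ler_wpM2l ?prodr_ge0 //.
have -> : k.+1 = (n - size h)%N by lia.
exact: val_step.
Qed.

Lemma sum_val_le :
  \sum_(s : {perm 'I_n}) \sum_(gs : {ffun 'I_n -> G})
    (\prod_i wt (gs i)) * val (trace s gs) <= n`!%:R * val [::].
Proof.
have := @sum_val_prefix n [::] (add0n n); rewrite big_nil mulr1.
rewrite pair_big; apply: le_trans; rewrite le_eqVlt; apply/orP; left.
by apply/eqP/eq_bigl => w; rewrite /= take0 eqxx.
Qed.

End RandomOrder.

(** * Sequential revealing with anchors, and its invariants *)

Section Exploration.
Variables (R : realType) (n q : nat) (mu : {ffun cfg n q -> R}).
Variables (nu0 : simplex R q) (x0 : cfg n q).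
Hypothesis mu_dist : is_dist mu.
Local Notation partial := ({set 'I_n} * cfg n q)%type.
Implicit Types (A B : partial) (u v : 'I_n) (st : nat * partial * partial).

(* A state [(N, A, B)]: [N] rounds have ended in a disagreement, the current one
   started from the partial configuration [A], and [B] is revealed by now. *)
Definition explore (G : Type) (coupling : G -> {set 'I_n} -> cfg n q -> 'I_n -> 'I_q)
    (st : nat * partial * partial) (ug : 'I_n * G) : nat * partial * partial :=
  let: (N, A, B) := st in
  let z := coupling ug.2 B.1 B.2 ug.1 in
  let B' := reveal B ug.1 z in
  if coupling ug.2 A.1 A.2 ug.1 == z then (N, A, B') else (N.+1, B', B').

Definition run (G : Type) coupling (h : seq ('I_n * G)) :=
  foldl (explore coupling) (0%N, (finset.set0, x0), (finset.set0, x0)) h.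

Lemma run_rcons G coupling (h : seq ('I_n * G)) ug :
  run coupling (rcons h ug) = explore coupling (run coupling h) ug.
Proof. exact: foldl_rcons. Qed.

Lemma explore_revealed G coupling st (ug : 'I_n * G) :
  (explore coupling st ug).2 = reveal st.2 ug.1 (coupling ug.2 st.2.1 st.2.2 ug.1).
Proof. by case: st => -[N A] B; rewrite /explore; case: ifP. Qed.

Lemma explore_rounds_le G coupling st (ug : 'I_n * G) :
  (st.1.1 <= (explore coupling st ug).1.1)%N.
Proof. by case: st => -[N A] B; rewrite /explore; case: ifP => //=. Qed.

Lemma run_revealed G coupling (h : seq ('I_n * G)) :
  (run coupling h).2.1 = [set u | u \in map fst h]%SET.
Proof.
elim/last_ind: h => [|h ug IH]; first by apply/setP => v; rewrite !inE.
rewrite run_rcons explore_revealed /= IH map_rcons; apply/setP => v.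
by rewrite !inE mem_rcons inE.
Qed.

Lemma cond_mass_set0 t : cond_mass mu finset.set0 t = 1.
Proof.
case/andP: mu_dist => _ /eqP <-; apply: eq_bigl => z.
by apply/forall_inP => j; rewrite inE.
Qed.

Lemma explore_extends G (coupling : G -> {set 'I_n} -> cfg n q -> 'I_n -> 'I_q)
    st (ug : 'I_n * G) : ug.1 \notin st.2.1 ->
  0 < cl mu nu0 st.2.1 st.2.2 ug.1 (coupling ug.2 st.2.1 st.2.2 ug.1) ->
  extends mu st.1.2 st.2 ->
  extends mu (explore coupling st ug).1.2 (explore coupling st ug).2.
Proof.
case: st => -[N A] B /= uB z0 AB; rewrite /explore; case: ifP => _ /=.
  exact: (extends_reveal mu_dist uB AB z0).
by apply: extends_refl; have [] := extends_reveal mu_dist uB AB z0.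
Qed.

(** Drawn values have positive conditional probability, so masses stay positive; the anchor only
    ever jumps to the current configuration, so the latter keeps extending it. *)
Lemma run_extends (G : eqType) (h : seq ('I_n * G)) coupling : uniq (map fst h) ->
  {in h, forall ug B, 0 < cl mu nu0 B.1 B.2 ug.1 (coupling ug.2 B.1 B.2 ug.1)} ->
  extends mu (run coupling h).1.2 (run coupling h).2.
Proof.
elim/last_ind: h => [|h ug IH] uh good /=.
  by apply: extends_refl; rewrite /positive cond_mass_set0.
move: uh; rewrite map_rcons rcons_uniq => /andP[ugh uh].
rewrite run_rcons; apply: explore_extends.
- by rewrite run_revealed inE.
- by apply: good; rewrite mem_rcons mem_head.
by apply: IH => // ug' h'; apply: good; rewrite mem_rcons in_cons h' orbT.
Qed.

End Exploration.

(** * The potential and an exponential moment of the number of disagreements *)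

Section Potential.
Variables (R : realType) (n q : nat) (mu : {ffun cfg n q -> R}).
Variable nu0 : simplex R q.
Hypothesis mu_dist : is_dist mu.
Hypothesis q_gt0 : (0 < q)%N.
Variables (G : finType) (coupling : G -> {set 'I_n} -> cfg n q -> 'I_n -> 'I_q).
Variable wt : G -> R.
Implicit Types (A B : {set 'I_n} * cfg n q) (u v : 'I_n) (g : G).

Let p B v x : R := cl mu nu0 B.1 B.2 v x.
Let drawn g B v := coupling g B.1 B.2 v.

Hypothesis wt_ge0 : forall g, 0 <= wt g.
Hypothesis wt_marginal : forall B v z, \sum_(g | drawn g B v == z) wt g = p B v z.
Hypothesis wt_disagree : forall A B v,
  \sum_(g | drawn g A v != drawn g B v) wt g <= \sum_x `|p B v x - p A v x|.

Variable l : nat.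
Hypothesis l_gt0 : (0 < l)%N.

Local Notation H B := (cross_entropy mu nu0 B B).
Local Notation L A B := (cross_entropy mu nu0 A B).

Definition hidden B := #|~: B.1|.

(** The fraction, capped at one, of a block of [l] reveals completed since the anchor [A]. *)
Definition theta A B : R := (minn (hidden A - hidden B) l)%:R / l%:R.

(* Interpolating from the cross entropy (a martingale) at the anchor [A] to the
   entropy after [l] reveals releases [KL/l] per reveal, which pays for a
   disagreement; after [l] reveals the term [theta] pays for it instead. *)
Definition potential A B : R :=
  2 * l%:R ^+ 2 / (hidden A)%:R * ((1 - theta A B) * L A B + theta A B * H B)
  + 2 * l%:R ^+ 2 * ln q%:R * ln (hidden A)%:R
  + 2 * (hidden B)%:R / l%:R + theta A B + (minn (hidden B) (2 * l))%:R.

Lemma hidden_reveal B u z : u \notin B.1 -> hidden B = (hidden (reveal B u z)).+1.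
Proof.
move=> uB; rewrite /hidden (cardsD1 u) inE uB add1n; congr _.+1.
by apply: eq_card => v; rewrite !inE negb_or.
Qed.

Lemma hidden_extends mu' A B : @extends R n q mu' A B -> (hidden B <= hidden A)%N.
Proof. by case=> AB _ _; apply: subset_leq_card; rewrite finset.setCS. Qed.

Lemma hidden_le B : (hidden B <= n)%N.
Proof. by rewrite -[leqRHS]card_ord max_card. Qed.

Lemma theta_ge0 A B : 0 <= theta A B.
Proof. by rewrite divr_ge0. Qed.

Lemma theta_le1 A B : theta A B <= 1.
Proof. by rewrite ler_pdivrMr ?ltr0n // mul1r ler_nat geq_minr. Qed.

Lemma theta_refl B : theta B B = 0.
Proof. by rewrite /theta subnn min0n mul0r. Qed.

Lemma mix_ge0 A B : 0 <= (1 - theta A B) * L A B + theta A B * H B.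
Proof.
by rewrite addr_ge0 // mulr_ge0 ?cross_entropy_ge0 ?theta_ge0 // subr_ge0 theta_le1.
Qed.

Lemma lnq_ge0 : 0 <= ln q%:R :> R.
Proof. by rewrite ln_ge0 // ler1n. Qed.

Lemma ln_nat_ge0 m : 0 <= ln m%:R :> R.
Proof. by case: m => [|m]; [rewrite ln0|rewrite ln_ge0 // ler1n]. Qed.

Lemma potential_ge0 A B : 0 <= potential A B.
Proof.
rewrite /potential !addr_ge0 ?theta_ge0 //.
- by rewrite mulr_ge0 ?mix_ge0 // divr_ge0 // mulr_ge0 // sqr_ge0.
- by rewrite !mulr_ge0 ?sqr_ge0 ?lnq_ge0 ?ln_nat_ge0.
Qed.

(* Re-anchoring uses [H <= r' ln q] and [1/r' - 1/r <= (ln r - ln r')/r']. *)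
Lemma potential_reanchor A B : extends mu A B -> (0 < hidden A)%N ->
  1 + potential B B <= potential A B + (1 - theta A B).
Proof.
move=> AB rA.
suff E : 2 * l%:R ^+ 2 / (hidden B)%:R * H B
    + 2 * l%:R ^+ 2 * ln q%:R * ln (hidden B)%:R <=
    2 * l%:R ^+ 2 / (hidden A)%:R * ((1 - theta A B) * L A B + theta A B * H B)
    + 2 * l%:R ^+ 2 * ln q%:R * ln (hidden A)%:R.
  rewrite /potential theta_refl subr0 mul1r mul0r !addr0; lra.
have mixH : H B <= (1 - theta A B) * L A B + theta A B * H B.
  have := entropy_le_cross_entropy nu0 mu_dist AB; have := theta_le1 A B; nra.
have Hq : H B <= (hidden B)%:R * ln q%:R by apply: entropy_le_card => //; case: AB.
have H0 : 0 <= H B by exact: cross_entropy_ge0.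
have l2 : 0 <= 2 * l%:R ^+ 2 :> R by rewrite mulr_ge0 // sqr_ge0.
have rA0 : 0 < (hidden A)%:R :> R by rewrite ltr0n.
have rBA : (hidden B)%:R <= (hidden A)%:R :> R by rewrite ler_nat (hidden_extends AB).
apply: (@le_trans _ _ (2 * l%:R ^+ 2 / (hidden A)%:R * H B
    + 2 * l%:R ^+ 2 * ln q%:R * ln (hidden A)%:R)); last first.
  by rewrite lerD2r ler_wpM2l // divr_ge0.
rewrite -!mulrA -!mulrDr !mulrA ler_wpM2l //.
(* With nothing hidden, the conventions [0^-1 = 0] and [ln 0 = 0] make the left side vanish. *)
have [->|rB] := posnP (hidden B).
  rewrite invr0 mul0r add0r (ln0 (lexx 0)) mulr0.
  by rewrite addr_ge0 ?mulr_ge0 ?invr_ge0 ?lnq_ge0 ?ln_nat_ge0.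
have rB0 : 0 < (hidden B)%:R :> R by rewrite ltr0n.
have h := @ln_le_subr1 R _ (divr_gt0 rB0 rA0).
rewrite ln_div ?posrE // in h.
have eE : H B / (hidden A)%:R = H B / (hidden B)%:R * ((hidden B)%:R / (hidden A)%:R).
  by field; rewrite !gt_eqF.
have Eq : H B / (hidden B)%:R <= ln q%:R by rewrite ler_pdivrMr // mulrC.
have s1 : (hidden B)%:R / (hidden A)%:R <= 1 :> R by rewrite ler_pdivrMr // mul1r.
rewrite ![_^-1 * _]mulrC eE.
move: (_ / _) (_ / (hidden A)%:R) (ln (hidden B)%:R) (ln (hidden A)%:R) lnq_ge0 Eq s1 h.
move: (ln _) => lq e s x y lq0 elq s1 h.
(* The two products combine to [e - e * s <= lq * (1 - s) <= lq * (y - x)]. *)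
have := mulr_ge0 lq0 (_ : 0 <= s - 1 - (x - y)).
have := @mulr_ge0 _ (lq - e) (1 - s).
rewrite !subr_ge0 => /(_ elq s1) h1 /(_ h) h2.
lra.
Qed.

Definition theta_next A B : R := (minn (hidden A - hidden B).+1 l)%:R / l%:R.

Lemma theta_reveal A B u z : u \notin B.1 -> extends mu A B ->
  theta A (reveal B u z) = theta_next A B.
Proof.
move=> uB /hidden_extends AB; rewrite /theta /theta_next; have hB := hidden_reveal z uB.
by rewrite hB subnSK // -hB.
Qed.

(** With the anchor kept, the cross entropy is preserved on average, the entropy does not grow, and
    the other terms depend only on how many coordinates are hidden. *)
Lemma potential_drift A B u : u \notin B.1 -> extends mu A B ->
  \sum_z p B u z * potential A (reveal B u z) <=
  2 * l%:R ^+ 2 / (hidden A)%:R * ((1 - theta_next A B) * L A B + theta_next A B * H B)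
  + 2 * l%:R ^+ 2 * ln q%:R * ln (hidden A)%:R
  + 2 * (hidden B).-1%:R / l%:R + theta_next A B + (minn (hidden B).-1 (2 * l))%:R.
Proof.
move=> uB AB; set th := theta_next A B.
have th0 : 0 <= th by rewrite divr_ge0.
under eq_bigr => z _.
  rewrite /potential (theta_reveal z uB AB) -/th.
  rewrite (_ : hidden (reveal B u z) = (hidden B).-1); last by rewrite (hidden_reveal z uB).
  rewrite -!addrA mulrDr mulrCA mulrDr [_ * ((1 - th) * _)]mulrCA [_ * (th * _)]mulrCA.
  over.
rewrite big_split /= -mulr_sumr big_split /= -!mulr_sumr -mulr_suml cl_sum mul1r.
rewrite !addrA !lerD2r ler_wpM2l //.
have Bp : positive mu B by case: AB.
rewrite cross_entropy_martingale // lerD2l ler_wpM2l //.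
exact: entropy_supermartingale.
Qed.

Lemma disagree_le1 A B v : \sum_(g | drawn g A v != drawn g B v) wt g <= 1.
Proof.
rewrite -(cl_sum mu nu0 B.1 B.2 v).
have <- : \sum_g wt g = \sum_z p B v z.
  rewrite (partition_big (fun g => drawn g B v) predT) //=.
  by apply: eq_bigr => z _; rewrite wt_marginal.
rewrite [leRHS](bigID (fun g => drawn g A v != drawn g B v)) /= lerDl.
exact: sumr_ge0.
Qed.

(** By [potential_reanchor] a disagreement costs at most [1 - th] beyond the drift with the anchor
    kept. This cost vanishes once [l] reveals have passed; before that it is paid by the [minn] term
    when at most [2 * l] coordinates are hidden, and by the divergence otherwise. *)
Lemma potential_step A B : extends mu A B ->
  \sum_(u | u \notin B.1) \sum_g wt g *
    (if drawn g A u == drawn g B u then potential A (reveal B u (drawn g B u))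
     else 1 + potential (reveal B u (drawn g B u)) (reveal B u (drawn g B u)))
  <= (hidden B)%:R * potential A B.
Proof.
move=> AB; have [r0|r_gt0] := posnP (hidden B).
  rewrite r0 mul0r big_pred0 // => u; have := cards0_eq r0.
  by move/setP/(_ u); rewrite !inE.
have rBA := hidden_extends AB; have rA_gt0 := leq_trans r_gt0 rBA.
pose dis u := \sum_(g | drawn g A u != drawn g B u) wt g.
pose th := theta_next A B.
have th1 : th <= 1 by rewrite ler_pdivrMr ?ltr0n // mul1r ler_nat geq_minr.
have th0 : 0 <= th by rewrite divr_ge0.
have dis0 u : 0 <= dis u by apply: sumr_ge0.
have step u : u \notin B.1 -> \sum_g wt g *
    (if drawn g A u == drawn g B u then potential A (reveal B u (drawn g B u))
     else 1 + potential (reveal B u (drawn g B u)) (reveal B u (drawn g B u)))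
  <= \sum_z p B u z * potential A (reveal B u z) + (1 - th) * dis u.
  move=> uB.
  have -> : \sum_z p B u z * potential A (reveal B u z) =
      \sum_g wt g * potential A (reveal B u (drawn g B u)).
    rewrite [RHS](partition_big (fun g => drawn g B u) predT) //=.
    apply: eq_bigr => z _; rewrite -wt_marginal mulr_suml.
    by apply: eq_bigr => g /eqP ->.
  rewrite /dis mulr_sumr [X in _ <= _ + X]big_mkcond -big_split /=.
  apply: ler_sum => g _; case: eqVneq => [_|_] /=; first by rewrite addr0.
  have [->|g0] := eqVneq (wt g) 0; first by rewrite !mul0r mulr0 addr0.
  rewrite [(1 - th) * _]mulrC -mulrDr ler_wpM2l //.
  rewrite /th -(theta_reveal (drawn g B u) uB AB); apply: potential_reanchor => //.
  have pg : 0 < p B u (drawn g B u).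
    by rewrite -wt_marginal (bigD1 g) //= ltr_wpDr ?sumr_ge0 // lt0r g0 wt_ge0.
  exact: extends_reveal pg.
apply: le_trans (ler_sum _ step) _.
apply: (@le_trans _ _ (\sum_(u | u \notin B.1)
  ((2 * l%:R ^+ 2 / (hidden A)%:R * ((1 - th) * L A B + th * H B)
  + 2 * l%:R ^+ 2 * ln q%:R * ln (hidden A)%:R
  + 2 * (hidden B).-1%:R / l%:R + th + (minn (hidden B).-1 (2 * l))%:R)
  + (1 - th) * dis u))).
  by apply: ler_sum => u uB; rewrite lerD2r; exact: potential_drift.
rewrite big_split /= -mulr_sumr sumr_const.
have cardB : #|[pred u | u \notin B.1]| = hidden B.
  by apply: eq_card => u; rewrite !inE.
rewrite cardB.
set dsum := \sum_(_ | _) _.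
have dsum0 : 0 <= dsum by apply: sumr_ge0.
have dsum1 : dsum <= (hidden B)%:R.
  apply: le_trans (ler_sum _ (fun u _ => disagree_le1 A B u)) _.
  by rewrite sumr_const cardB.
(* Divergences are nonnegative, so their sum over hidden coordinates is at most the sum over all,
   [L A B - H B]. *)
have dsum2 : dsum <= (hidden B)%:R / l%:R + l%:R * (L A B - H B).
  apply: (@le_trans _ _ (\sum_(u | u \notin B.1) (l%:R^-1 + l%:R * kl mu nu0 A B u))).
    apply: ler_sum => u _; apply: le_trans (wt_disagree A B u) _.
    exact: dist_le_kl.
  rewrite big_split /= sumr_const cardB -mulr_sumr -kl_sumE.
  rewrite [(hidden B)%:R / _]mulr_natl lerD2l ler_wpM2l //.
  rewrite [leRHS](bigID (fun u => u \notin B.1)) /= lerDl.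
  by apply: sumr_ge0 => u _; exact: kl_ge0.
have LH : H B <= L A B by exact: entropy_le_cross_entropy.
rewrite -[_ *+ hidden B]mulr_natl /potential.
have r_pos : 0 < (hidden B)%:R :> R by rewrite ltr0n.
have l_pos : 0 < l%:R :> R by rewrite ltr0n.
have rA_pos : 0 < (hidden A)%:R :> R by rewrite ltr0n.
have thN : th = theta A B + (if (hidden A - hidden B < l)%N then l%:R^-1 else 0).
  rewrite /th /theta_next /theta; case: ltnP => kl.
    by rewrite (minn_idPl kl) -natr1 mulrDl mul1r.
  by rewrite (minn_idPr (leqW kl)) addr0.
set m := (minn (hidden B) (2 * l))%:R; set m' := (minn (hidden B).-1 (2 * l))%:R.
have r1 : (hidden B).-1%:R = (hidden B)%:R - 1 :> R by rewrite -[in RHS](prednK r_gt0) -natr1 addrK.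
have mm : m' <= m by rewrite ler_nat; clear; lia.
suff key : (1 - th) * dsum <= (hidden B)%:R * (
    2 * l%:R ^+ 2 / (hidden A)%:R * (th - theta A B) * (L A B - H B)
    + 2 / l%:R - (th - theta A B) + (m - m')).
  rewrite -lerBrDl; apply: le_trans key _; rewrite -mulrBr ler_wpM2l //.
  rewrite r1 le_eqVlt; apply/orP; left; apply/eqP; ring.
(* After [l] reveals [theta] stays at one and re-anchoring is free. *)
case: ltnP thN => [kl|kl] thN; last first.
  have e1 : th = 1.
    by rewrite /th /theta_next (minn_idPr (leqW kl)) divff // gt_eqF.
  have e0 : theta A B = 1 by rewrite -e1 thN addr0.
  rewrite e1 e0 subrr mul0r mulr_ge0 // mulr0 mul0r add0r subr0.
  by rewrite addr_ge0 ?divr_ge0 // subr_ge0.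
have -> : th - theta A B = l%:R^-1 by rewrite thN addrAC subrr add0r.
apply: (@le_trans _ _ dsum); first by rewrite ler_piMl // gerBl.
have KL0 : 0 <= L A B - H B by rewrite subr_ge0.
have -> : 2 * l%:R ^+ 2 / (hidden A)%:R / l%:R = 2 * l%:R / (hidden A)%:R :> R.
  by field; rewrite !gt_eqF.
(* Each reveal frees [2 / l]: half pays for the growth of [theta], half for the additive [l^-1] of
   [dist_le_kl]. *)
have e X : X + 2 / l%:R - l%:R^-1 = X + l%:R^-1 :> R by lra.
rewrite {}e.
(* Among the last [2 * l] hidden coordinates the [minn] term drops by one, which covers the trivial
   bound [dsum1]. *)
have [r2l|r2l] := leqP (hidden B) (2 * l).
  have -> : m - m' = 1.
    by rewrite /m /m' (minn_idPl r2l) (minn_idPl (leq_trans (leq_pred _) r2l)) r1; lra.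
  apply: le_trans dsum1 _; rewrite ler_peMr // lerDr addr_ge0 ?invr_ge0 //.
  by rewrite mulr_ge0 // divr_ge0 // mulr_ge0.
apply: le_trans dsum2 _; rewrite -subr_ge0 in mm.
apply: (@le_trans _ _ ((hidden B)%:R *
  (2 * l%:R / (hidden A)%:R * (L A B - H B) + l%:R^-1))); last first.
  by rewrite ler_wpM2l // lerDl.
(* Fewer than [l] reveals since [A] and more than [2 * l] coordinates still hidden: so [hidden B]
   times [2 * l / hidden A] is at least [l]. *)
have rA2 : (hidden A <= 2 * hidden B)%N by move: rBA r2l kl; clear; lia.
rewrite [leLHS]addrC [leRHS]mulrDr lerD2r mulrA ler_wpM2r // mulrA ler_pdivlMr //.
rewrite -!natrM ler_nat; move: rA2; clear; nia.
Qed.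
Definition potential_bound : R :=
  2 * l%:R ^+ 2 * ln q%:R * (1 + ln n%:R) + 2 * n%:R / l%:R + 2 * l%:R.

(** At a fresh anchor only the plain entropy remains, and its bound by [hidden B] times [ln q]
    cancels the division by [hidden B]. *)
Lemma potential_refl_le B : (0 < n)%N -> positive mu B ->
  potential B B <= potential_bound.
Proof.
move=> n_gt0 Bp; rewrite /potential theta_refl subr0 mul1r mul0r !addr0.
have l2 : 0 <= 2 * l%:R ^+ 2 :> R by rewrite mulr_ge0 // sqr_ge0.
rewrite /potential_bound mulrDr mulr1; apply: lerD; last first.
  by rewrite -natrM ler_nat geq_minr.
apply: lerD; last first.
  by rewrite ler_wpM2r ?invr_ge0 // ler_wpM2l // ler_nat hidden_le.
apply: lerD.
  rewrite -[_ / _ * _]mulrA ler_wpM2l //.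
  have [->|r_gt0] := posnP (hidden B); first by rewrite invr0 mul0r lnq_ge0.
  by rewrite ler_pdivrMl ?ltr0n // entropy_le_card.
rewrite ler_wpM2l ?mulr_ge0 ?lnq_ge0 //.
have [->|r_gt0] := posnP (hidden B); first by rewrite (ln0 (lexx 0)) ln_nat_ge0.
by rewrite ler_ln ?posrE ?ltr0n // ler_nat hidden_le.
Qed.

Lemma sum_wt : (0 < n)%N -> cfg n q -> \sum_g wt g = 1.
Proof.
move=> n_gt0 t; rewrite -(cl_sum mu nu0 finset.set0 t (Ordinal n_gt0)).
rewrite (partition_big (fun g => drawn g (finset.set0, t) (Ordinal n_gt0)) predT) //=.
by apply: eq_bigr => z _; rewrite wt_marginal.
Qed.

(** [(1 + lam) ^+ N * (1 + 2 * lam * potential)] is a supermartingale along the exploration, at most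
    2 at the start, and dominates [(1 + lam) ^+ N] at the end. *)
Lemma sum_rounds_le (x0 : cfg n q) (lam : R) : (0 < n)%N ->
  0 <= lam -> 2 * lam * potential_bound <= 1 ->
  \sum_(s : {perm 'I_n}) \sum_(gs : {ffun 'I_n -> G})
    (\prod_i wt (gs i)) * (1 + lam) ^+ (run x0 coupling (trace s gs)).1.1
  <= n`!%:R * 2.
Proof.
move=> n_gt0 lam0 lamB.
have lam2 : 0 <= 2 * lam by rewrite mulr_ge0.
pose val (h : seq ('I_n * G)) : R := let st := run x0 coupling h in
  (1 + lam) ^+ st.1.1 * (1 + 2 * lam * potential st.1.2 st.2).
have pow0 k : 0 <= (1 + lam) ^+ k by rewrite exprn_ge0 // addr_ge0.
have val_ge0 h : 0 <= val h.
  by rewrite mulr_ge0 // addr_ge0 // !mulr_ge0 // potential_ge0.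
have empty_pos : positive mu (finset.set0, x0) by rewrite /positive cond_mass_set0.
have pos_drawn g B u : wt g != 0 -> 0 < p B u (drawn g B u).
  by move=> g0; rewrite -wt_marginal (bigD1 g) //= ltr_wpDr ?sumr_ge0 // lt0r g0 wt_ge0.
apply: (@le_trans _ _ (n`!%:R * val [::])); last first.
  rewrite ler_wpM2l // /val /= expr0 mul1r -[2]/(1 + 1) lerD2l.
  apply: le_trans lamB; rewrite ler_wpM2l ?mulr_ge0 //.
  exact: (@potential_refl_le (finset.set0, x0)).
have val_step h : uniq (map fst h) -> all (fun x => 0 < wt x.2) h -> (size h < n)%N ->
    \sum_(u | u \notin map fst h) \sum_g wt g * val (rcons h (u, g)) <=
    (n - size h)%:R * val h.
  move=> uh wh hn.
  have AB : extends mu (run x0 coupling h).1.2 (run x0 coupling h).2.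
    apply: (run_extends (nu0 := nu0)) => // ug ugh B; apply: pos_drawn.
    by have /allP/(_ _ ugh) := wh; rewrite lt0r => /andP[].
  have revealedE := run_revealed x0 coupling h.
  have hB : hidden (run x0 coupling h).2 = (n - size h)%N.
    rewrite /hidden cardsCs finset.setCK card_ord revealedE cardsE.
    by rewrite (card_uniqP uh) size_map.
  have memB u : (u \notin map fst h) = (u \notin (run x0 coupling h).2.1).
    by rewrite revealedE inE.
  rewrite (eq_bigl _ _ memB) -hB /val.
  under eq_bigr do under eq_bigr do rewrite run_rcons.
  move: (run x0 coupling h) AB {uh wh hn revealedE hB memB} => [[N A] B] /= AB.
  pose X u g := if drawn g A u == drawn g B u then potential A (reveal B u (drawn g B u))
    else 1 + potential (reveal B u (drawn g B u)) (reveal B u (drawn g B u)).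
  apply: (@le_trans _ _ (\sum_(u | u \notin B.1) \sum_g
      wt g * ((1 + lam) ^+ N * (1 + 2 * lam * X u g)))).
    apply: ler_sum => u uB; apply: ler_sum => g _.
    have [->|g0] := eqVneq (wt g) 0; first by rewrite !mul0r.
    rewrite ler_wpM2l // /X /drawn; case: ifP => //= _.
    rewrite exprSr -mulrA ler_wpM2l //.
    have B'p : positive mu (reveal B u (drawn g B u)).
      by have [] := extends_reveal mu_dist uB AB (pos_drawn g B u g0).
    have := le_trans (ler_wpM2l lam2 (potential_refl_le n_gt0 B'p)) lamB.
    (* From [2 * lam * x <= 1] follows [(1 + lam) * (1 + 2 * lam * x) <= 1 + 2 * lam * (1 + x)]. *)
    rewrite /drawn; move: (potential _ _) => x; nra.
  have e u g : wt g * ((1 + lam) ^+ N * (1 + 2 * lam * X u g)) =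
      (1 + lam) ^+ N * (wt g + 2 * lam * (wt g * X u g)) by ring.
  under eq_bigr => u _.
    under eq_bigr do rewrite e.
    rewrite -mulr_sumr big_split /= sum_wt // -mulr_sumr.
    over.
  rewrite -mulr_sumr [leRHS]mulrCA ler_wpM2l // big_split /= -mulr_sumr sumr_const.
  have -> : #|[pred u | u \notin B.1]| = hidden B by apply: eq_card => u; rewrite !inE.
  rewrite mulrDr mulr1 lerD2l [leRHS]mulrCA ler_wpM2l ?mulr_ge0 //.
  exact: potential_step.
apply: le_trans (sum_val_le wt_ge0 val_ge0 val_step).
apply: ler_sum => s _; apply: ler_sum => gs _.
rewrite ler_wpM2l ?prodr_ge0 // /val ler_peMr // lerDl !mulr_ge0 //.
exact: potential_ge0.
Qed.

End Potential.

(** * Pathwise comparison of the parallel sampler with the exploration *)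

Lemma bigminn_eq (n : nat) (Q : pred 'I_n) (k0 : 'I_n) : Q k0 ->
  (forall k, Q k -> (k0 <= k)%N) ->
  \big[minn/n]_(k : 'I_n | Q k) (k : nat) = k0.
Proof.
move=> Qk0 k0min; apply/eqP; rewrite eqn_leq; apply/andP; split.
  by rewrite -minEnat -leEnat; exact: (bigmin_le_cond _ (fun k : 'I_n => k : nat)).
elim/big_ind: _ => [|x y hx hy|k /k0min //]; first exact: ltnW.
by rewrite leq_min hx.
Qed.

Section Pathwise.
Variables (R : realType) (n q : nat) (mu : {ffun cfg n q -> R}).
Variables (nu0 : simplex R q) (x0 : cfg n q).
Hypothesis mu_dist : is_dist mu.
Variables (d : measure_display) (Omega : measurableType d).
Variables (f : simplex R q -> Omega -> 'I_q) (s : {perm 'I_n}) (u : 'I_n -> Omega).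

Definition coupled (r : Omega) (S : {set 'I_n}) (t : cfg n q) (v : 'I_n) : 'I_q :=
  f (cond_law mu nu0 S t v) r.

Hypothesis in_support : forall i (B : {set 'I_n} * cfg n q) v,
  0 < cl mu nu0 B.1 B.2 v (coupled (u i) B.1 B.2 v).

Let st i := run x0 coupled (take i (trace s u)).
Let revealed i := (st i).2.
Let out := (revealed n).2.

Let stS (i : 'I_n) : st i.+1 = explore coupled (st i) (s i, u i).
Proof. by rewrite /st take_traceS run_rcons. Qed.

Lemma mem_prefix_set k (j : 'I_n) : (s j \in prefix_set s k) = (j < k)%N.
Proof.
apply/imsetP/idP => [[j' j'k /perm_inj ->]|jk]; first by rewrite inE in j'k.
by exists j => //; rewrite inE.
Qed.

Let revealed_prefix k : (revealed k).1 = prefix_set s k.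
Proof.
rewrite /revealed /st run_revealed; apply/setP => v.
rewrite -(permKV s v) mem_prefix_set inE /trace -map_take -map_comp.
rewrite (mem_map (@perm_inj _ s)).
set j := (s^-1)%g v.
have [nk|kn] := leqP n k.
  by rewrite take_oversize ?size_enum_ord // mem_enum (leq_trans (ltn_ord j) nk).
rewrite -(mem_map val_inj) map_take val_enum_ord take_iota mem_iota /=.
by rewrite add0n (minn_idPl (ltnW kn)).
Qed.

Let rounds_le a b : (a <= b <= n)%N -> ((st a).1.1 <= (st b).1.1)%N.
Proof.
case/andP; elim: b => [|b IH]; first by rewrite leqn0 => /eqP ->.
rewrite leq_eqVlt => /predU1P[->//|]; rewrite ltnS => ab bn.
apply: leq_trans (IH ab (ltnW bn)) _.
by rewrite (stS (Ordinal bn)) explore_rounds_le.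
Qed.

Let revealed_val (j : 'I_n) k : (j < k <= n)%N ->
  (revealed k).2 (s j) = coupled (u j) (revealed j).1 (revealed j).2 (s j).
Proof.
case/andP; elim: k => // k IH; rewrite ltnS leq_eqVlt => /predU1P[jk|jk] kn.
  by rewrite -jk /revealed stS explore_revealed /= updE.
rewrite -(IH jk (ltnW kn)) /revealed (stS (Ordinal kn)) explore_revealed /=.
rewrite upd_other //; apply: contraTneq jk => /perm_inj ->.
by rewrite /= ltnn.
Qed.

Let revealed_out k : (k <= n)%N -> {in prefix_set s k, (revealed k).2 =1 out}.
Proof.
move=> kn v; rewrite -(permKV s v) mem_prefix_set => jk.
by rewrite /out !revealed_val ?jk ?kn // ltn_ord leqnn.
Qed.

Let law_out k (x : cfg n q) v : (k <= n)%N -> {in prefix_set s k, x =1 out} ->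
  cond_law mu nu0 (prefix_set s k) x v = cond_law mu nu0 (revealed k).1 (revealed k).2 v.
Proof.
move=> kn xout; rewrite revealed_prefix; apply: cond_law_agree => w wk.
by rewrite xout // revealed_out.
Qed.

Let outE (j : 'I_n) : out (s j) = coupled (u j) (revealed j).1 (revealed j).2 (s j).
Proof. by rewrite /out revealed_val // ltn_ord leqnn. Qed.

Let revealed_pos k : extends mu (st k).1.2 (st k).2.
Proof.
apply: (run_extends (nu0 := nu0)) => //; first exact: uniq_trace.
by move=> ug /mem_take /mapP[i _ ->] B; exact: in_support.
Qed.

(** Each round that does not halt accounts for one disagreement of the exploration. The invariant is
    that the first [a] positions agree with the sequential output [out] and that the exploration is
    freshly anchored at step [a]. *)
Lemma rounds_of_not_halting T a (x : cfg n q) : (a <= n)%N ->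
  {in prefix_set s a, x =1 out} -> (st a).1.2 = (st a).2 ->
  ~~ halts_within mu nu0 f s u T a x -> ((st a).1.1 + T <= (st n).1.1)%N.
Proof.
elim: T a x => [|T IH] a x an xout fresh; first by rewrite addn0 rounds_le // an leqnn.
rewrite /=; set y := round_y _ _ _ _ _ _ _; set x' := round_x _ _ _ _ _ _.
rewrite negb_or => /andP[x'y].
have [k1 k1P] : exists k, y (s k) != x' (s k).
  have [v yv] : exists v, x' v != y v.
    apply/existsP; apply: contraNT x'y; rewrite negb_exists => /forallP h.
    by apply/eqP/ffunP => v; apply/eqP; rewrite -[_ == _]negbK.
  by exists (s^-1 v)%g; rewrite permKV eq_sym.
have [k0 k0P k0min] := @arg_minnP _ k1 (fun k => y (s k) != x' (s k)) val k1P.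
rewrite (bigminn_eq k0P k0min) negb_or => /andP[_ nhalt].
have yE j : y (s j) = coupled (u j) (revealed a).1 (revealed a).2 (s j).
  by rewrite ffunE permK /coupled law_out.
(* These coordinates are revealed, so their law is a point mass, and positive probability of the
   drawn value forces equality. *)
have y_before (j : 'I_n) : (j < a)%N -> y (s j) = out (s j).
  move=> ja; rewrite -(revealed_out an) ?mem_prefix_set // yE.
  have := in_support j (revealed a) (s j).
  rewrite cl_revealed //; last first.
  - by have [] := revealed_pos a.
  - by rewrite revealed_prefix mem_prefix_set.
  by case: eqP => // _; rewrite ltxx.
(* Strong induction: before [k0], [y] agrees with [x'] and hence with [out], so [x'] draws from the
   same law as the sequential process. *)
have x'_out (j : 'I_n) : (j <= k0)%N -> x' (s j) = out (s j).
  have [m] := ubnP (nat_of_ord j); elim: m j => // m IHm j jm jk0.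
  rewrite ffunE permK outE /coupled; congr (f _ _); apply: law_out => [|v].
    exact/ltnW/ltn_ord.
  rewrite -(permKV s v) mem_prefix_set => vj.
  rewrite -IHm ?(leq_trans vj) //; last by apply: leq_trans jk0; exact: ltnW.
  apply/eqP; apply: contraTT vj => /k0min; rewrite -leqNgt; exact: leq_trans.
have ak0 : (a <= k0)%N.
  rewrite leqNgt; apply: contraNN k0P => k0a; by rewrite y_before // x'_out.
(* No disagreement occurs from step [a] up to [k0], so the counter and the anchor stand still. *)
have st_eq k : (a <= k <= k0)%N -> st k = ((st a).1.1, (st a).2, (st k).2).
  case/andP; elim: k => [|k IHk].
    by rewrite leqn0 => /eqP a0 _; move: fresh; rewrite a0; case: (st 0) => -[? ?] ? /= ->.
  rewrite leq_eqVlt => /predU1P[ak _|].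
    by move: fresh; rewrite ak; case: (st _) => -[? ?] ? /= ->.
  rewrite ltnS => ak kk0; have kn := ltn_trans kk0 (ltn_ord k0).
  rewrite (stS (Ordinal kn)) /=; have := IHk ak (ltnW kk0); case E : (st k) => [[N A] B] [-> ->].
  rewrite /explore /=; have -> : coupled (u (Ordinal kn)) (st a).2.1 (st a).2.2 (s (Ordinal kn)) =
      coupled (u (Ordinal kn)) B.1 B.2 (s (Ordinal kn)); last by rewrite eqxx.
  have rk : revealed (Ordinal kn) = B by rewrite /revealed /= E.
  rewrite -/(revealed a) -yE -rk -outE -x'_out ?(ltnW kk0) //.
  apply/eqP; apply: contraTT kk0 => /k0min /=; by rewrite -leqNgt.
(* Step [k0] is the disagreement; the new anchor includes position [k0] itself, as does the
   sampler's prefix of length [k0.+1]. *)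
have stk0 : st k0.+1 = ((st a).1.1.+1, revealed k0.+1, revealed k0.+1).
  rewrite /revealed stS explore_revealed /=; have := st_eq k0; rewrite ak0 leqnn => /(_ isT) ->.
  rewrite /explore /= -/(revealed a) -yE -/(revealed k0) -outE -x'_out //.
  by rewrite (negbTE k0P).
have := IH k0.+1 x' (ltn_ord k0) _ _ nhalt; rewrite stk0 /= addSnnS; apply => //.
move=> v; rewrite -(permKV s v) mem_prefix_set ltnS; exact: x'_out.
Qed.

Lemma not_halting_rounds T : ~~ halts_within mu nu0 f s u T 0 x0 ->
  (T <= (run x0 coupled (trace s u)).1.1)%N.
Proof.
move=> nh; have := rounds_of_not_halting (leq0n n) _ _ nh.
rewrite /st take0 /= add0n take_oversize ?size_trace //; apply => //.
by move=> v /imsetP[j]; rewrite inE.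
Qed.

End Pathwise.

(** * Reduction to a finite probability space, and the tail bound *)

Lemma finite_fibers d (T : measurableType d) (R : realType)
    (P : {measure set T -> \bar R}) (G : finType) (h : T -> G) (Q : pred G) :
  (forall g, measurable [set r | h r = g]) ->
  measurable [set r | Q (h r)] /\
  P [set r | Q (h r)] = (\sum_(g | Q g) P [set r | h r = g])%E.
Proof.
move=> mh.
have seqP (s : seq G) : uniq s -> measurable [set r | h r \in s] /\
    P [set r | h r \in s] = (\sum_(g <- s) P [set r | h r = g])%E.
  elim: s => [_|g s IH /= /andP[gs /IH[ms Ps]]].
    have -> : [set r | h r \in [::]] = set0 by apply/seteqP; split.
    by rewrite measure0 big_nil.
  have -> : [set r | h r \in g :: s] = [set r | h r = g] `|` [set r | h r \in s].
    apply/seteqP; split=> r /=; rewrite inE.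
      by move=> /predU1P[]; [left|right].
    by move=> [->|->]; rewrite ?eqxx ?orbT.
  split; first exact: measurableU.
  rewrite big_cons -Ps; apply: measureU => //.
  by apply/seteqP; split=> r //= [->]; exact/negP.
have [mQ PQ] := seqP (enum Q) (enum_uniq Q).
have -> : [set r | Q (h r)] = [set r | h r \in enum Q].
  by apply/seteqP; split=> r /=; rewrite mem_enum.
by rewrite PQ big_enum.
Qed.

Lemma run_map n q (x0 : cfg n q) (G G' : Type) coupling coupling' (phi : G -> G')
    (h : seq ('I_n * G)) :
  (forall r S t v, coupling' (phi r) S t v = coupling r S t v) ->
  run x0 coupling' [seq (x.1, phi x.2) | x <- h] = run x0 coupling h.
Proof.
move=> phiE; rewrite /run; elim: h (_, _) => //= -[u r] h IH [[N A] B] /=.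
by rewrite !phiE IH.
Qed.

Section TailBound.
Variables (R : realType) (n q : nat) (mu : {ffun cfg n q -> R}).
Variables (nu0 : simplex R q) (x0 : cfg n q).
Hypotheses (n_gt0 : (0 < n)%N) (q_gt0 : (0 < q)%N) (mu_dist : is_dist mu).
Variables (d : measure_display) (Omega : measurableType d) (P : probability Omega R).
Variable f : simplex R q -> Omega -> 'I_q.
Hypothesis f_robust : robust_coupler P f.
Variables (d' : measure_display) (Omega' : measurableType d').
Variables (P' : probability Omega' R) (sigma : Omega' -> {perm 'I_n}).
Variable U : 'I_n -> Omega' -> Omega.
Hypothesis random : sampler_randomness P P' sigma U.

Local Notation index := ({set 'I_n} * cfg n q * 'I_n)%type.
Local Notation table := {ffun index -> 'I_q}.
Local Notation law k := (cond_law mu nu0 k.1.1 k.1.2 k.2).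

(* Only the values of [f] at the finitely many conditional laws matter. *)
Definition table_of (r : Omega) : table := [ffun k : index => f (law k) r].

Definition lookup (g : table) (S : {set 'I_n}) (t : cfg n q) (v : 'I_n) : 'I_q :=
  g (S, t, v).

Definition table_prob (g : table) : R := fine (P [set r | table_of r = g]).

Lemma lookup_table_of r S t v :
  lookup (table_of r) S t v = coupled mu nu0 f r S t v.
Proof. by rewrite /lookup ffunE. Qed.

Lemma measurable_table g : measurable [set r | table_of r = g].
Proof.
have -> : [set r | table_of r = g] =
    \bigcap_(k in [set: index]) [set r | f (law k) r = g k].
  apply/seteqP; split=> r /=; first by move=> <- k _; rewrite /= ffunE.
  by move=> h; apply/ffunP => k; rewrite ffunE; exact: h.
apply: fin_bigcap_measurable => [|k _]; first exact: finite_finset.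
by have [/(_ (law k) (g k)) []] := f_robust.
Qed.

Lemma table_prob_ge0 g : 0 <= table_prob g.
Proof. exact/fine_ge0/measure_ge0. Qed.

Lemma table_probE g : P [set r | table_of r = g] = (table_prob g)%:E.
Proof. by rewrite fineK // fin_num_measure //; exact: measurable_table. Qed.

Lemma sum_table_prob (Q : pred table) :
  P [set r | Q (table_of r)] = (\sum_(g | Q g) table_prob g)%:E.
Proof.
have [_ ->] := finite_fibers P Q measurable_table.
by rewrite -sumEFin; apply: eq_bigr => g _; exact: table_probE.
Qed.

Lemma table_marginal (B : {set 'I_n} * cfg n q) v z :
  \sum_(g | lookup g B.1 B.2 v == z) table_prob g = cl mu nu0 B.1 B.2 v z.
Proof.
apply: EFin_inj; rewrite -sum_table_prob.
have [/(_ (cond_law mu nu0 B.1 B.2 v) z) [_ <-] _] := f_robust; congr (P _).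
apply/seteqP; split=> r /=; rewrite lookup_table_of; first by move/eqP.
by move=> e; apply/eqP.
Qed.

(** Robustness for two laws: maximum minus minimum is the absolute difference, and the sum of maxima
    in the denominator is at least one. *)
Lemma table_disagree (A B : {set 'I_n} * cfg n q) v :
  \sum_(g | lookup g A.1 A.2 v != lookup g B.1 B.2 v) table_prob g <=
  \sum_x `|cl mu nu0 B.1 B.2 v x - cl mu nu0 A.1 A.2 v x|.
Proof.
pose nu (i : 'I_2) := if i == ord0 then cond_law mu nu0 A.1 A.2 v else cond_law mu nu0 B.1 B.2 v.
have [_ /(_ 2%N nu isT)] := f_robust.
have -> : [set r | exists i j, f (nu i) r <> f (nu j) r] =
    [set r | lookup (table_of r) A.1 A.2 v != lookup (table_of r) B.1 B.2 v].
  apply/seteqP; split=> r /=; rewrite !lookup_table_of /coupled.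
    move=> [i [j]]; rewrite /nu => fij; apply/negP => /eqP e; apply: fij.
    by case: ifP; case: ifP; rewrite ?e.
  by move=> /eqP fAB; exists ord0, ord_max.
rewrite (sum_table_prob (fun g => lookup g A.1 A.2 v != lookup g B.1 B.2 v)) lee_fin.
move=> /le_trans; apply.
(* The defaults 0 and 1 of the iterated extrema are harmless, since probabilities lie in between. *)
have maxE x : \big[Order.max/0]_(i < 2) sval (nu i) x =
    Num.max (cl mu nu0 A.1 A.2 v x) (cl mu nu0 B.1 B.2 v x).
  by rewrite !big_ord_recl big_ord0 /nu /= (max_l (simplex_ge0 _ _)).
have minE x : \big[Order.min/1]_(i < 2) sval (nu i) x =
    Num.min (cl mu nu0 A.1 A.2 v x) (cl mu nu0 B.1 B.2 v x).
  by rewrite !big_ord_recl big_ord0 /nu /= (min_l (cl_le1 mu nu0 B.1 B.2 v x)).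
have -> : \sum_x (\big[Order.max/0]_(i < 2) sval (nu i) x -
      \big[Order.min/1]_(i < 2) sval (nu i) x) =
    \sum_x `|cl mu nu0 B.1 B.2 v x - cl mu nu0 A.1 A.2 v x|.
  apply: eq_bigr => x _; rewrite maxE minE.
  by case: (leP (cl mu nu0 A.1 A.2 v x)) => ab;
    [rewrite ger0_norm ?subr_ge0|rewrite ltr0_norm ?subr_lt0 ?opprB].
have S1 : 1 <= \sum_x \big[Order.max/0]_(i < 2) sval (nu i) x.
  rewrite -(cl_sum mu nu0 A.1 A.2 v); apply: ler_sum => x _.
  by rewrite maxE le_max lexx.
rewrite ler_pdivrMr ?(lt_le_trans ltr01) // ler_peMr //.
by apply: sumr_ge0.
Qed.

Let outcome w : {perm 'I_n} * {ffun 'I_n -> table} :=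
  (sigma w, [ffun i => table_of (U i w)]).

Let halts w T := halts_within mu nu0 f (sigma w) (fun i => U i w) T 0 x0.

Let outcome_set s gs : [set w | outcome w = (s, gs)] =
  [set w | sigma w = s /\ forall i, [set r | table_of r = gs i] (U i w)].
Proof.
apply/seteqP; split=> w /=; first by move=> [-> <-]; split=> // i; rewrite ffunE.
by move=> [<- h]; congr pair; apply/ffunP => i; rewrite ffunE h.
Qed.

Let outcome_prob s gs : P' [set w | outcome w = (s, gs)] =
  ((n`!%:R)^-1 * \prod_i table_prob (gs i))%:E.
Proof.
rewrite outcome_set.
have [_ [_ /(_ s (fun i => [set r | table_of r = gs i]))->]] := random; last first.
  by move=> i; exact: measurable_table.
rewrite EFinM -prodEFin; congr (_ * _)%E.
by apply: eq_bigr => i _; rewrite table_probE.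
Qed.

Let measurable_outcome z : measurable [set w | outcome w = z].
Proof.
case: z => s gs; have -> : [set w | outcome w = (s, gs)] = sigma @^-1` [set s] `&`
    \bigcap_(i in [set: 'I_n]) (U i @^-1` [set r | table_of r = gs i]).
  rewrite outcome_set; apply/seteqP; split=> w /= [? h]; split=> //.
    by move=> i _; exact: h.
  by move=> i; exact: (h i).
have [ms [mU _]] := random; apply: measurableI => //.
apply: fin_bigcap_measurable => [|i _]; first exact: finite_finset.
rewrite -[X in measurable X]setTI.
exact: mU (measurable_table _).
Qed.

Let halts_outcome w w' T : outcome w = outcome w' -> halts w T = halts w' T.
Proof.
move=> [sE /ffunP gE]; rewrite /halts sE.
have fE v S t i : f (cond_law mu nu0 S t v) (U i w) = f (cond_law mu nu0 S t v) (U i w').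
  by have := gE i; rewrite !ffunE => /ffunP/(_ (S, t, v)); rewrite !ffunE.
elim: T 0%N x0 => //= T IH a x.
have -> : round_y mu nu0 f (sigma w') (fun i => U i w) a x =
    round_y mu nu0 f (sigma w') (fun i => U i w') a x.
  by apply/ffunP => v; rewrite !ffunE fE.
set y := round_y _ _ _ _ _ _ _.
have -> : round_x mu nu0 f (sigma w') (fun i => U i w) y =
    round_x mu nu0 f (sigma w') (fun i => U i w') y.
  by apply/ffunP => v; rewrite !ffunE fE.
by rewrite IH.
Qed.

(** A saturated event is a union of fibres of the finite-valued map [outcome], so [finite_fibers]
    applies to it. *)
Let outcome_saturated (E : set Omega') : (forall w w', outcome w = outcome w' -> E w -> E w') ->
  E = [set w | (fun z => `[< exists2 w', outcome w' = z & E w' >]) (outcome w)].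
Proof.
move=> sat; apply/seteqP; split=> w /=; first by move=> Ew; apply/asboolP; exists w.
by move=> /asboolP[w' /sat]; apply.
Qed.

Lemma measurable_halts (D : set nat) : measurable [set w | exists t, D t /\ halts w t].
Proof.
have sat w w' : outcome w = outcome w' ->
    [set w | exists t, D t /\ halts w t] w -> [set w | exists t, D t /\ halts w t] w'.
  by move=> ww' [t [Dt h]]; exists t; rewrite -(halts_outcome t ww').
rewrite (outcome_saturated sat).
by have [] := finite_fibers P' (fun z => `[< exists2 w', outcome w' = z &
  [set w | exists t, D t /\ halts w t] w' >]) measurable_outcome.
Qed.

(** Markov's inequality for [(1 + lam) ^+ N], carried out as a finite sum over outcomes;
    [not_halting_rounds] gives [N >= T] on failing outcomes of nonzero weight. *)
Lemma not_halting_prob (l T : nat) (lam : R) : (0 < l)%N -> 0 <= lam ->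
  2 * lam * potential_bound R n q l <= 1 ->
  (P' [set w | ~~ halts w T] <= (2 / (1 + lam) ^+ T)%:E)%E.
Proof.
move=> l_gt0 lam0 lamB.
have T0 : 0 < (1 + lam) ^+ T by rewrite exprn_gt0 // ltr_pwDl.
have sat w w' : outcome w = outcome w' ->
    [set w | ~~ halts w T] w -> [set w | ~~ halts w T] w'.
  by move=> /(halts_outcome T) /= ->.
rewrite (outcome_saturated sat).
have [_ ->] := finite_fibers P'
  (fun z => `[< exists2 w', outcome w' = z & ~~ halts w' T >]) measurable_outcome.
rewrite (eq_bigr (fun z : {perm 'I_n} * {ffun 'I_n -> table} =>
  ((n`!%:R)^-1 * \prod_i table_prob (z.2 i))%:E)); last first.
  by move=> [s gs] _; exact: outcome_prob.
rewrite sumEFin lee_fin -mulr_sumr.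
have f0 : 0 < n`!%:R :> R by rewrite ltr0n fact_gt0.
rewrite ler_pdivrMl // mulrA ler_pdivlMr //.
have := sum_rounds_le (nu0 := nu0) mu_dist q_gt0 table_prob_ge0 table_marginal
  table_disagree l_gt0 x0 n_gt0 lam0 lamB.
apply: le_trans; rewrite pair_big /= mulr_suml [leLHS]big_mkcond.
apply: ler_sum => -[s gs] _ /=.
have w0 : 0 <= \prod_i table_prob (gs i) by apply: prodr_ge0 => i _; exact: table_prob_ge0.
case: ifPn => [/asboolP[w [sE gE] nh]|_]; last first.
  by rewrite mulr_ge0 // exprn_ge0 // addr_ge0.
(* Nonzero weight makes every drawn value have positive conditional probability, as the pathwise
   comparison requires. *)
have [->|wN0] := eqVneq (\prod_i table_prob (gs i)) 0; first by rewrite !mul0r.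
rewrite ler_wpM2l // ler_weXn2l ?lerDl //.
have gsE i : gs i = table_of (U i w) by rewrite -gE ffunE.
have -> : run x0 lookup (trace s gs) = run x0 (coupled mu nu0 f) (trace s (fun i => U i w)).
  rewrite -(run_map x0 (trace s (fun i => U i w)) lookup_table_of) -map_comp.
  by congr run; apply: eq_map => i /=; rewrite gsE.
apply: not_halting_rounds => //; last by rewrite -sE.
move=> i B v; rewrite -table_marginal (bigD1 (table_of (U i w))) /=; last first.
  by rewrite lookup_table_of.
rewrite ltr_wpDr ?sumr_ge0 // => [g _|]; first exact: table_prob_ge0.
rewrite -gsE lt0r table_prob_ge0 andbT.
by apply: contraNneq wN0 => g0; rewrite (bigD1 i) //= g0 mul0r.
Qed.

End TailBound.

(** * Optimising the block length *)

Section BlockLength.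
Variable R : realType.

Lemma ln_nat_ge_half m : (2 <= m)%N -> 2^-1 <= ln m%:R :> R.
Proof.
move=> m2; have h2 : 2 <= m%:R :> R by rewrite ler_nat.
have := @ln_le_subr1 R m%:R^-1; rewrite invr_gt0 (lt_le_trans _ h2) // => /(_ isT).
rewrite lnV ?posrE ?(lt_le_trans _ h2) // => h.
have : m%:R^-1 <= 2^-1 :> R by rewrite lef_pV2 ?posrE // (lt_le_trans _ h2).
by move: h; move: (ln _) (_^-1) => x y; lra.
Qed.

(* The block length balancing [l^2 ln n] against [n / l] is about
   [n / (n ln n)^(2/3)]. *)
Lemma exists_block_length n q : (2 <= n)%N -> (2 <= q)%N ->
  let Q := (n%:R * ln n%:R) `^ (2 / 3) : R in
  exists l, [/\ (0 < l)%N, 0 < potential_bound R n q l,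
    potential_bound R n q l <= 88 * Q * ln q%:R & 1 <= Q].
Proof.
move=> n2 q2 Q.
have Ln := ln_nat_ge_half n2; have Lq := ln_nat_ge_half q2.
have n2R : 2 <= n%:R :> R by rewrite ler_nat.
have Lnn : ln n%:R <= n%:R :> R by rewrite ltW // ln_sublinear // (lt_le_trans _ n2R).
have Q0 : 0 <= Q by rewrite powR_ge0.
(* The exponent [2 / 3] is handled through cubes, leaving polynomial inequalities. *)
have Q3 : Q ^+ 3 = (n%:R * ln n%:R) ^+ 2.
  have a0 : 0 <= n%:R * ln n%:R :> R by nra.
  by rewrite -powR_mulrn // -powRrM divfK // powR_mulrn.
rewrite /potential_bound; move: (ln n%:R) (ln q%:R) Ln Lq Lnn Q Q0 Q3 => L K hL hK Ly Q Q0 Q3.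
set y : R := n%:R in n2R Ly Q3 *.
have L0 : 0 < L by lra.
have K0 : 0 < K by lra.
have yL1 : 1 <= y * L by nra.
have Q1 : 1 <= Q.
  by rewrite -(@ler_pXn2r _ 3) // ?nnegrE // expr1n Q3 exprn_ege1.
have LQ : L <= Q.
  rewrite -(@ler_pXn2r _ 3) // ?nnegrE ?(ltW L0) // Q3 exprMn exprS ler_wpM2r ?sqr_ge0 //.
  nra.
pose x := y / Q.
have Qp : 0 < Q by lra.
have xQ : x * Q = y by rewrite divfK // gt_eqF.
have x0 : 0 <= x by rewrite divr_ge0 //; lra.
have xL : x ^+ 2 * L <= 2 * Q.
  rewrite -(ler_pM2r (exprn_gt0 2 Qp)) -[leRHS]mulrA -exprS Q3.
  have -> : x ^+ 2 * L * Q ^+ 2 = y ^+ 2 * L by rewrite -xQ; ring.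
  have : 0 <= y ^+ 2 * L * (2 * L - 1) by rewrite !mulr_ge0 ?sqr_ge0 ?(ltW L0) //; lra.
  lra.
have /andP[l1 l2] := truncn_itv x0.
(* Rounding [x] strictly upwards keeps the length positive and adds at most one. *)
exists (Num.truncn x).+1; rewrite -[(_.+1)%:R]natr1 in l2 *.
move: (Num.truncn x)%:R l1 l2 (ler0n R (Num.truncn x)) => k kx xk k0.
have l2L : (k + 1) ^+ 2 * L <= 6 * Q.
  have kx2 : k ^+ 2 <= x ^+ 2 by rewrite lerXn2r ?nnegrE.
  have : (k + 1) ^+ 2 <= 2 * x ^+ 2 + 2 by have := sqr_ge0 (k - 1); lra.
  by move/(ler_wpM2r (ltW L0)); lra.
have l_sqr : k + 1 <= (k + 1) ^+ 2 by nra.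
have yl : y / (k + 1) <= Q by rewrite ler_pdivrMr -?xQ; nra.
have yl0 : 0 <= y / (k + 1) by rewrite divr_ge0; lra.
have QK : Q <= 2 * (Q * K) by nra.
have l_sqrL : (k + 1) ^+ 2 <= 2 * ((k + 1) ^+ 2 * L) by have := sqr_ge0 (k + 1); nra.
have l_le : k + 1 <= 12 * Q by lra.
have llK : 0 <= (k + 1) ^+ 2 * K by rewrite mulr_ge0 ?sqr_ge0 // ltW.
have first_term : (k + 1) ^+ 2 * K * (1 + L) <= 18 * (Q * K).
  have -> : (k + 1) ^+ 2 * K * (1 + L) = ((k + 1) ^+ 2 + (k + 1) ^+ 2 * L) * K by ring.
  rewrite mulrA ler_pM2r //; lra.
have e1 : 2 * (k + 1) ^+ 2 * K * (1 + L) = 2 * ((k + 1) ^+ 2 * K * (1 + L)) by ring.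
have e2 : 2 * y / (k + 1) = 2 * (y / (k + 1)) by rewrite mulrA.
have first_ge0 : 0 <= (k + 1) ^+ 2 * K * (1 + L) by rewrite mulr_ge0 //; lra.
have e3 : 88 * Q * K = 88 * (Q * K) by rewrite mulrA.
(* The three terms are at most 36, 4 and 48 times [Q * K], which add up to 88. *)
rewrite e1 e2 e3; split=> //; lra.
Qed.

End BlockLength.

(** * Choice of the constant and amplification to failure probability [2 ^- c] *)

Theorem theorem3p12 :
  exists M : Rdefinitions.R, 0 < M /\
  forall (n q : nat), (2 <= n)%N -> (2 <= q)%N ->
  forall (mu : {ffun cfg n q -> Rdefinitions.R}), is_dist mu ->
  forall (nu0 : simplex Rdefinitions.R q) (x0 : cfg n q),
  forall (d : measure_display) (Omega : measurableType d)
         (P : probability Omega Rdefinitions.R)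
         (f : simplex Rdefinitions.R q -> Omega -> 'I_q),
  robust_coupler P f ->
  forall (d' : measure_display) (Omega' : measurableType d')
         (P' : probability Omega' Rdefinitions.R)
         (sigma : Omega' -> {perm 'I_n}) (U : 'I_n -> Omega' -> Omega),
  sampler_randomness P P' sigma U ->
  forall c : nat, (1 <= c)%N ->
  let E := [set w | exists t : nat,
              t%:R <= c%:R * M * (n%:R * ln n%:R) `^ (2 / 3) * ln q%:R /\
              halts_within mu nu0 f (sigma w) (fun i => U i w) t 0 x0] in
  measurable E /\ ((1 - 2 ^- c)%:E <= P' E)%E.
Proof.
(* The bound reached for [T] is [178 * 2 * c * (Q * K)], so 400 leaves room. *)
exists 400; split=> [|n q n2 q2]; first by rewrite ltr0n.
move=> mu mu_dist nu0 x0 d Omega P f f_robust d' Omega' P' sigma U random c c1 E.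
have n_gt0 : (0 < n)%N by exact: ltnW.
have q_gt0 : (0 < q)%N by exact: ltnW.
pose halts w t := halts_within mu nu0 f (sigma w) (fun i => U i w) t 0 x0.
have mD (D : set nat) : measurable [set w | exists t, D t /\ halts w t].
  exact: (measurable_halts mu nu0 x0 f_robust random D).
have mE : measurable E by exact: (mD [set t : nat | t%:R <= _]).
split=> //.
have [l [l_gt0 B0 BQ Q1]] := exists_block_length Rdefinitions.R n2 q2.
rewrite /E; set B := potential_bound _ n q l in B0 BQ; set Q := _ `^ _ in BQ Q1 *.
have Lq := ln_nat_ge_half Rdefinitions.R q2.
set K := ln q%:R in BQ Lq *.
(* [N] is the least integer above [2 * B], enough for Bernoulli's inequality to give
   [(1 + lam) ^+ N >= 2]. *)
pose N := (Num.truncn (2 * B)).+1; pose lam := (2 * B)^-1.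
have B2 : 0 < 2 * B by rewrite mulr_gt0.
have /andP[N1 N2] : (Num.truncn (2 * B))%:R <= 2 * B < N%:R by rewrite truncn_itv // ltW.
have lam0 : 0 <= lam by rewrite invr_ge0 ltW.
have lamB : 2 * lam * B <= 1 by rewrite mulrAC divff // gt_eqF.
(* One block of [N] rounds beyond [c] cancels the factor 2 in [not_halting_prob]. *)
pose T := (N * c.+1)%N.
have bernoulli k : 1 + k%:R * lam <= (1 + lam) ^+ k.
  elim: k => [|k IH]; first by rewrite mul0r addr0.
  rewrite exprS -natr1; have := mulr_ge0 (ler0n _ k) (sqr_ge0 lam).
  have := ler_wpM2l (addr_ge0 ler01 lam0) IH; clear; lra.
have twice : 2 <= (1 + lam) ^+ N.
  apply: le_trans (bernoulli N); rewrite -[2]/(1 + 1) lerD2l.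
  by rewrite ler_pdivlMr // mul1r ltW.
have T_le : T%:R <= c%:R * 400 * Q * K.
  have K0 : 0 <= K by exact: le_trans Lq.
  have QK : 1 <= 2 * (Q * K) by have := ler_wpM2r K0 Q1; rewrite mul1r; move: Lq; clear; lra.
  (* Here [178 = 2 * 88 + 2], the rounding error 1 being at most [2 * (Q * K)]. *)
  have NB : N%:R <= 178 * (Q * K) by move: N1 BQ QK; rewrite /N -natr1 -mulrA; clear; lra.
  have cc : c.+1%:R <= 2 * c%:R :> Rdefinitions.R.
    by rewrite -natrM ler_nat mul2n -addnn -addn1 leq_add2l.
  rewrite natrM; apply: le_trans (ler_pM _ _ NB cc) _ => //.
  have -> : c%:R * 400 * Q * K = 400 * (c%:R * (Q * K)) by ring.
  have : 0 <= c%:R * (Q * K) by rewrite !mulr_ge0 // (le_trans _ Q1).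
  clear; lra.
pose F := [set w | halts w T].
have mF : measurable F.
  have -> : F = [set w | exists t, [set T] t /\ halts w t].
    by apply/seteqP; split=> w /=; [exists T|case=> t [->]].
  exact: mD.
have fail := not_halting_prob nu0 x0 n_gt0 q_gt0 mu_dist f_robust random T l_gt0 lam0 lamB.
have FE : (P' F <= P' E)%E.
  by apply: le_measure; rewrite ?inE // => w Fw; exists T.
apply: le_trans FE; rewrite -[F]setCK probability_setC; last exact: measurableC.
have -> : ~` F = [set w | ~~ halts w T].
  by apply/seteqP; split=> w /=; [move/negP|move/negP].
rewrite EFinB leeB //; apply: le_trans fail _; rewrite lee_fin.
rewrite /T exprM ler_pdivrMr; last by rewrite !exprn_gt0 // ltr_pwDl.
rewrite -ler_pdivrMl ?invr_gt0 ?exprn_gt0 // invrK -exprSr.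
by rewrite lerXn2r // nnegrE // (le_trans _ twice).
Qed.
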